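(* Let $\psi\in C([0,T]\times\overline{\mathcal O};\mathbb R)$. If $u,v:[0,T]\times\overline{\mathcal O}\to\mathbb R$ are bounded, $u$ is an usc viscosity subsolution and $v$ is a lsc viscosity supersolution of $\mathrm{VI}_{\min}[\psi]$, then $u\le v$ on $[0,T]\times\overline{\mathcal O}$.
   Context: Standing assumptions: $\mathcal O\subset\mathbb R^d$ bounded open of class $W^{2,\infty}$ with outward unit normal $n$; $\gamma:\mathbb R^d\to\mathbb R^d$ Lipschitz with $\gamma\cdot n\ge c_0>0$ on $\partial\mathcal O$; $b\in C([0,T]\times\overline{\mathcal O};\mathbb R^d)$, $\sigma\in C([0,T]\times\overline{\mathcal O};\mathbb R^{d\times m})$, Lipschitz in space uniformly in time. $H(t,x,p)=\frac12|\sigma(t,x)^Tp|^2-b(t,x)\cdot p$. $\mathrm{VI}_{\min}[\psi]$: $\min(-\partial_tw+H(t,x,Dw),w-\psi)=0$ in $[0,T)\times\mathcal O$, $\partial w/\partial\gamma=0$ on $[0,T)\times\partial\mathcal O$, $w(T)=\psi(T)$ on $\overline{\mathcal O}$. Let $E(t,x,r,q,p)=\min(-q+H(t,x,p),r-\psi(t,x))$ and, for $\varphi\in C^1([0,T]\times\overline{\mathcal O})$, $E_0=E(t_0,x_0,w(t_0,x_0),\partial_t\varphi(t_0,x_0),D\varphi(t_0,x_0))$, $\partial_\gamma\varphi=D\varphi(t_0,x_0)\cdot\gamma(x_0)$. Subsolution (bounded usc $w$): at every local maximum $(t_0,x_0)$ of $w-\varphi$, $E_0\le0$ if $x_0\in\mathcal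 O$ and $\min(E_0,\partial_\gamma\varphi)\le0$ if $x_0\in\partial\mathcal O$ (any $t_0\in[0,T]$). Supersolution (bounded lsc $w$): at every local minimum $(t_0,x_0)$ of $w-\varphi$: $E_0\ge0$ if $t_0<T,x_0\in\mathcal O$; $w(t_0,x_0)-\psi(t_0,x_0)\ge0$ if $t_0=T,x_0\in\mathcal O$; $\max(E_0,\partial_\gamma\varphi)\ge0$ if $t_0<T,x_0\in\partial\mathcal O$; $\max(w(t_0,x_0)-\psi(t_0,x_0),\partial_\gamma\varphi)\ge0$ if $t_0=T,x_0\in\partial\mathcal O$. *)

(* Defs.v *)
From mathcomp Require Import all_boot.
From Stdlib Require Import Reals.
Set Implicit Arguments.
Unset Strict Implicit.
Local Open Scope R_scope.

Definition vec (d : nat) := 'I_d -> R.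
Definition mat (d m : nat) := 'I_d -> 'I_m -> R.
Definition rsum (k : nat) (f : 'I_k -> R) : R := \big[Rplus/0]_(i < k) f i.
Definition dot (d : nat) (x y : vec d) : R := rsum (fun i => x i * y i).
Definition vnorm (d : nat) (x : vec d) : R := sqrt (dot x x).
Definition vsub (d : nat) (x y : vec d) : vec d := fun i => x i - y i.
Definition vdist (d : nat) (x y : vec d) : R := vnorm (vsub x y).
Definition trmul (d m : nat) (s : mat d m) (p : vec d) : vec m :=
  fun j => rsum (fun i => s i j * p i).
Definition mdist (d m : nat) (s1 s2 : mat d m) : R :=
  sqrt (rsum (fun i => rsum (fun j => (s1 i j - s2 i j) ^ 2))).

Definition is_open (d : nat) (A : vec d -> Prop) : Prop :=
  forall x, A x -> exists r, 0 < r /\ forall y, vdist y x < r -> A y.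
Definition is_bounded (d : nat) (A : vec d -> Prop) : Prop :=
  exists M, forall x, A x -> vnorm x <= M.
Definition clos (d : nat) (A : vec d -> Prop) (x : vec d) : Prop :=
  forall r, 0 < r -> exists y, A y /\ vdist y x < r.
Definition bdry (d : nat) (A : vec d -> Prop) (x : vec d) : Prop :=
  clos A x /\ ~ A x.

Definition has_grad (d : nat) (f : vec d -> R) (Df : vec d -> vec d) : Prop :=
  forall x eps, 0 < eps -> exists delta, 0 < delta /\
    forall y, vdist y x < delta ->
      Rabs (f y - f x - dot (Df x) (vsub y x)) <= eps * vdist y x.

Definition C1 (d : nat) (phi phit : R -> vec d -> R) (Dphi : R -> vec d -> vec d) : Prop :=
  (forall t x eps, 0 < eps -> exists delta, 0 < delta /\
     forall s y, Rabs (s - t) < delta -> vdist y x < delta ->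
       Rabs (phi s y - phi t x - phit t x * (s - t) - dot (Dphi t x) (vsub y x))
         <= eps * (Rabs (s - t) + vdist y x)) /\
  (forall t x eps, 0 < eps -> exists delta, 0 < delta /\
     forall s y, Rabs (s - t) < delta -> vdist y x < delta ->
       Rabs (phit s y - phit t x) < eps /\ vdist (Dphi s y) (Dphi t x) < eps).

(* ---------- The domain: bounded open set of class W^{2,oo} with outward
   unit normal n.  Described by a C^{1,1} (= W^{2,oo}_loc) defining function
   rho with O = {rho < 0}, D rho <> 0 on the bdry, n = D rho / |D rho|. *)
Definition W2inf_domain (d : nat) (O : vec d -> Prop) (n : vec d -> vec d) : Prop :=
  is_bounded O /\ is_open O /\
  exists (rho : vec d -> R) (Drho : vec d -> vec d),
    has_grad rho Drho /\
    (exists L, forall x y, vdist (Drho x) (Drho y) <= L * vdist x y) /\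
    (forall x, O x <-> rho x < 0) /\
    (forall x, bdry O x ->
       vnorm (Drho x) <> 0 /\ forall i, n x i = Drho x i / vnorm (Drho x)).

Definition inQ (d : nat) (T : R) (O : vec d -> Prop) (t : R) (x : vec d) : Prop :=
  0 <= t <= T /\ clos O x.

Definition bounded_on_Q (d : nat) (T : R) (O : vec d -> Prop) (w : R -> vec d -> R) : Prop :=
  exists M, forall t x, inQ T O t x -> Rabs (w t x) <= M.

Definition usc_on_Q (d : nat) (T : R) (O : vec d -> Prop) (w : R -> vec d -> R) : Prop :=
  forall t x, inQ T O t x -> forall eps, 0 < eps -> exists delta, 0 < delta /\
    forall s y, inQ T O s y -> Rabs (s - t) < delta -> vdist y x < delta ->
      w s y < w t x + eps.

Definition lsc_on_Q (d : nat) (T : R) (O : vec d -> Prop) (w : R -> vec d -> R) : Prop :=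
  forall t x, inQ T O t x -> forall eps, 0 < eps -> exists delta, 0 < delta /\
    forall s y, inQ T O s y -> Rabs (s - t) < delta -> vdist y x < delta ->
      w t x - eps < w s y.

Definition cont_on_Q (d : nat) (T : R) (O : vec d -> Prop) (w : R -> vec d -> R) : Prop :=
  forall t x, inQ T O t x -> forall eps, 0 < eps -> exists delta, 0 < delta /\
    forall s y, inQ T O s y -> Rabs (s - t) < delta -> vdist y x < delta ->
      Rabs (w s y - w t x) < eps.

Definition vcont_on_Q (d : nat) (T : R) (O : vec d -> Prop) (b : R -> vec d -> vec d) : Prop :=
  forall t x, inQ T O t x -> forall eps, 0 < eps -> exists delta, 0 < delta /\
    forall s y, inQ T O s y -> Rabs (s - t) < delta -> vdist y x < delta ->
      vdist (b s y) (b t x) < eps.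

Definition mcont_on_Q (d m : nat) (T : R) (O : vec d -> Prop) (s : R -> vec d -> mat d m) : Prop :=
  forall t x, inQ T O t x -> forall eps, 0 < eps -> exists delta, 0 < delta /\
    forall t' y, inQ T O t' y -> Rabs (t' - t) < delta -> vdist y x < delta ->
      mdist (s t' y) (s t x) < eps.

Definition loc_max_Q (d : nat) (T : R) (O : vec d -> Prop) (f : R -> vec d -> R)
  (t0 : R) (x0 : vec d) : Prop :=
  inQ T O t0 x0 /\ exists r, 0 < r /\
    forall t x, inQ T O t x -> Rabs (t - t0) < r -> vdist x x0 < r -> f t x <= f t0 x0.

Definition loc_min_Q (d : nat) (T : R) (O : vec d -> Prop) (f : R -> vec d -> R)
  (t0 : R) (x0 : vec d) : Prop :=
  inQ T O t0 x0 /\ exists r, 0 < r /\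
    forall t x, inQ T O t x -> Rabs (t - t0) < r -> vdist x x0 < r -> f t0 x0 <= f t x.

Definition Ham (d m : nat) (b : R -> vec d -> vec d) (sigma : R -> vec d -> mat d m)
  (t : R) (x p : vec d) : R :=
  / 2 * (vnorm (trmul (sigma t x) p)) ^ 2 - dot (b t x) p.

Definition Eop (d m : nat) (b : R -> vec d -> vec d) (sigma : R -> vec d -> mat d m)
  (psi : R -> vec d -> R) (t : R) (x : vec d) (r q : R) (p : vec d) : R :=
  Rmin (- q + Ham b sigma t x p) (r - psi t x).

Definition visc_sub (d m : nat) (T : R) (O : vec d -> Prop) (gamma : vec d -> vec d)
  (b : R -> vec d -> vec d) (sigma : R -> vec d -> mat d m) (psi : R -> vec d -> R)
  (w : R -> vec d -> R) : Prop :=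
  forall (phi phit : R -> vec d -> R) (Dphi : R -> vec d -> vec d) (t0 : R) (x0 : vec d),
    C1 phi phit Dphi ->
    loc_max_Q T O (fun t x => w t x - phi t x) t0 x0 ->
    let E0 := Eop b sigma psi t0 x0 (w t0 x0) (phit t0 x0) (Dphi t0 x0) in
    let dg := dot (Dphi t0 x0) (gamma x0) in
    (O x0 -> E0 <= 0) /\
    (bdry O x0 -> Rmin E0 dg <= 0).

Definition visc_super (d m : nat) (T : R) (O : vec d -> Prop) (gamma : vec d -> vec d)
  (b : R -> vec d -> vec d) (sigma : R -> vec d -> mat d m) (psi : R -> vec d -> R)
  (w : R -> vec d -> R) : Prop :=
  forall (phi phit : R -> vec d -> R) (Dphi : R -> vec d -> vec d) (t0 : R) (x0 : vec d),
    C1 phi phit Dphi ->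
    loc_min_Q T O (fun t x => w t x - phi t x) t0 x0 ->
    let E0 := Eop b sigma psi t0 x0 (w t0 x0) (phit t0 x0) (Dphi t0 x0) in
    let dg := dot (Dphi t0 x0) (gamma x0) in
    (t0 < T -> O x0 -> E0 >= 0) /\
    (t0 = T -> O x0 -> w t0 x0 - psi t0 x0 >= 0) /\
    (t0 < T -> bdry O x0 -> Rmax E0 dg >= 0) /\
    (t0 = T -> bdry O x0 -> Rmax (w t0 x0 - psi t0 x0) dg >= 0).

(* Main.v *)
(** Suppose [u - v] is positive somewhere. For [lam < 1] close to [1] one doubles
    the variables in
      [lam u(t,x) - v(s,y) + beta t - delta (rho(x) + rho(y))
         - l (t-s)^2 - k^2 A_z (x-y) . (x-y) - k |x-z|^2],
    where [rho] is a defining function of the domain and [A_z] is a positive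
    symmetric matrix, Lipschitz in [z], mapping [gamma] to a multiple of the
    normal at boundary points.  Since [z] is an independent variable, the test
    functions are [C^{1,1}] in [x] and in [y] although [A] is only Lipschitz;
    optimality in [z] gives [k |x-z| <= C theta] with [theta = k^2 |x-y|^2], and
    [theta -> 0] as [k -> oo].  The term [delta rho] then makes the oblique
    derivatives strict, so the boundary alternatives are void.  The factor
    [lam < 1] and the convexity of [H] in [p] absorb
    [|sigma(t,x)^T p|^2 - |sigma(s,y)^T p|^2], leaving errors of order
    [theta + delta + (theta + delta)^2 / (1 - lam)], too small for the strict gain
    [beta] provided by [beta t].  At [s = T] one uses instead [u(T,.) <= psi(T,.)], which follows from the subsolution
    property by penalizing with [K (T - t)], [K] large. *)
Require Import Defs.
From HB Require Import structures.
From mathcomp Require Import all_boot.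
From Stdlib Require Import Reals Lra Psatz Classical FunctionalExtensionality.
Set Implicit Arguments.
Unset Strict Implicit.
Local Open Scope R_scope.


(** The obstacle is the quadratic growth of [H]. For momenta [p] of size [k^2 |x-y|], the increment
    of [|sigma^T p|^2] between [x] and [y] is of order [|x-y| |p|^2], that is [k^4 |x-y|^3], which
    [theta] does not control. Convexity trades it for [(|x-y| |p|)^2], of order [theta^2], at the
    price [1 / (1 - lam)]. The coefficients are merely continuous in time, so the increment in
    [t - s] has to be beaten against powers of [k]; hence a separate weight [l], chosen after [k].
    The constants are fixed in the order [lam] and [beta], [delta], the bound on [theta], [k], [l].
    The weight [delta] is small compared with [beta] and [1 - lam], so that the losses stay below
    the gain; [theta] is small compared with [delta], so that the strict sign due to [delta rho]
    survives. The subsolution inequality is available up to [t = T], the differential part of the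
    supersolution inequality only for [s < T]; this asymmetry singles out the case [s = T]. *)

HB.instance Definition _ := Monoid.isComLaw.Build R 0 Rplus
  (fun x y z => esym (Rplus_assoc x y z)) Rplus_comm Rplus_0_l.

Definition vadd (d : nat) (x y : vec d) : vec d := fun i => x i + y i.
Definition vscal (d : nat) (a : R) (x : vec d) : vec d := fun i => a * x i.

(** * Euclidean algebra on [vec d] *)

Lemma rsumD k (f g : 'I_k -> R) : rsum (fun i => f i + g i) = rsum f + rsum g.
Proof. by rewrite /rsum big_split. Qed.

Lemma rsumZ k a (f : 'I_k -> R) : rsum (fun i => a * f i) = a * rsum f.
Proof.
rewrite /rsum; elim/big_rec2: _ => [|i y1 y2 _ ->]; ring.
Qed.

Lemma rsum_le k (f g : 'I_k -> R) : (forall i, f i <= g i) -> rsum f <= rsum g.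
Proof.
move=> H; rewrite /rsum; elim/big_rec2: _ => [|i y1 y2 _ h]; first lra.
have := H i; lra.
Qed.

Lemma rsum_ge0 k (f : 'I_k -> R) : (forall i, 0 <= f i) -> 0 <= rsum f.
Proof.
move=> H; rewrite /rsum; elim/big_rec: _ => [|i y _ h]; first lra.
have := H i; lra.
Qed.

Lemma rsum_term_le k (f : 'I_k -> R) i : (forall j, 0 <= f j) -> f i <= rsum f.
Proof.
move=> H; rewrite /rsum (bigD1 i) //=.
suff: 0 <= \big[Rplus/0]_(j < k | j != i) f j by move=> h1; set q := bigop _ _ _ in h1 *; lra.
elim/big_rec: _ => [|j y _ h]; first lra.
have := H j; lra.
Qed.

Lemma rsum_const k c : rsum (fun _ : 'I_k => c) = INR k * c.
Proof.
rewrite /rsum big_const card_ord.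
elim: k => [|k IH]; first by rewrite /=; lra.
by rewrite iterS IH S_INR; lra.
Qed.

Lemma dotC d (x y : vec d) : dot x y = dot y x.
Proof. by rewrite /dot; congr rsum; apply: functional_extensionality => i; ring. Qed.

Lemma dotDl d (x y z : vec d) : dot (vadd x y) z = dot x z + dot y z.
Proof.
rewrite /dot -rsumD; congr rsum.
by apply: functional_extensionality => i; rewrite /vadd; ring.
Qed.

Lemma dotZl d a (x z : vec d) : dot (vscal a x) z = a * dot x z.
Proof.
rewrite /dot -rsumZ; congr rsum.
by apply: functional_extensionality => i; rewrite /vscal; ring.
Qed.

Lemma vsubE d (x y : vec d) : vsub x y = vadd x (vscal (-1) y).
Proof. by apply: functional_extensionality => i; rewrite /vsub /vadd /vscal; ring. Qed.

Lemma dotBl d (x y z : vec d) : dot (vsub x y) z = dot x z - dot y z.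
Proof. by rewrite vsubE dotDl dotZl; lra. Qed.

Lemma dotDr d (x y z : vec d) : dot z (vadd x y) = dot z x + dot z y.
Proof. by rewrite dotC dotDl !(dotC z). Qed.

Lemma dotZr d a (x z : vec d) : dot z (vscal a x) = a * dot z x.
Proof. by rewrite dotC dotZl (dotC z). Qed.

Lemma dotBr d (x y z : vec d) : dot z (vsub x y) = dot z x - dot z y.
Proof. by rewrite dotC dotBl !(dotC z). Qed.

Definition dotE := (dotDl, dotDr, dotBl, dotBr, dotZl, dotZr).

Lemma dot_vsub_diag d (w x : vec d) : dot w (vsub x x) = 0.
Proof. by rewrite dotBr; ring. Qed.

Lemma dot_ge0 d (x : vec d) : 0 <= dot x x.
Proof. by apply: rsum_ge0 => i; nra. Qed.

Lemma vnorm_ge0 d (x : vec d) : 0 <= vnorm x.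
Proof. exact: sqrt_pos. Qed.

Lemma vnorm2 d (x : vec d) : vnorm x * vnorm x = dot x x.
Proof. exact: sqrt_sqrt (dot_ge0 x). Qed.

Lemma dot_sqr d (x y : vec d) : dot x y * dot x y <= dot x x * dot y y.
Proof.
have Y0 := dot_ge0 y.
have h t : 0 <= dot x x + 2 * t * dot x y + t * t * dot y y.
  by have := dot_ge0 (vadd x (vscal t y)); rewrite !dotE (dotC y x); lra.
case: (Rle_lt_or_eq_dec _ _ Y0) => [Yp|Yz].
  have := dot_ge0 (vadd (vscal (dot y y) x) (vscal (- dot x y) y)).
  rewrite !dotE (dotC y x) => k; nra.
rewrite -Yz in h *; case: (Req_dec (dot x y) 0) => [->|Dn]; first lra.
(* When [dot y y = 0], the polynomial in [h] is affine in [t]; with a nonzero slope it would take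
   the value -1 at this [t]. *)
have := h (- (dot x x + 1) / (2 * dot x y)).
have -> : dot x x + 2 * (- (dot x x + 1) / (2 * dot x y)) * dot x y
  + - (dot x x + 1) / (2 * dot x y) * (- (dot x x + 1) / (2 * dot x y)) * 0 = - 1
  by field.
lra.
Qed.

Lemma dot_vnorm d (x y : vec d) : dot x y <= vnorm x * vnorm y.
Proof.
have px := vnorm_ge0 x; have py := vnorm_ge0 y.
have := dot_sqr x y; rewrite -(vnorm2 x) -(vnorm2 y) => h.
have k : 0 <= vnorm x * vnorm y by nra.
nra.
Qed.

Lemma vnorm_scal d a (x : vec d) : vnorm (vscal a x) = Rabs a * vnorm x.
Proof.
rewrite {1}/vnorm !dotE -Rmult_assoc sqrt_mult; last exact: dot_ge0; last nra.
by rewrite -/(Rsqr a) sqrt_Rsqr_abs.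
Qed.

Lemma dot_abs d (x y : vec d) : Rabs (dot x y) <= vnorm x * vnorm y.
Proof.
apply: Rabs_le; split; last exact: dot_vnorm.
have := dot_vnorm (vscal (-1) x) y; rewrite vnorm_scal dotE.
rewrite Rabs_left; lra.
Qed.

Lemma vnorm_le d (x : vec d) b : 0 <= b -> dot x x <= b * b -> vnorm x <= b.
Proof. by move=> b0 h; have := vnorm2 x; have := vnorm_ge0 x; nra. Qed.

Lemma vnormD d (x y : vec d) : vnorm (vadd x y) <= vnorm x + vnorm y.
Proof.
have px := vnorm_ge0 x; have py := vnorm_ge0 y.
apply: vnorm_le; first lra.
rewrite !dotE (dotC y x) -!vnorm2.
have := dot_vnorm x y; nra.
Qed.

Lemma vnormB d (x y : vec d) : vnorm (vsub x y) <= vnorm x + vnorm y.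
Proof.
rewrite vsubE; apply: Rle_trans (vnormD _ _) _.
by rewrite vnorm_scal Rabs_left; lra.
Qed.

Lemma vdistC d (x y : vec d) : vdist x y = vdist y x.
Proof.
rewrite /vdist.
have -> : vsub x y = vscal (-1) (vsub y x).
  by apply: functional_extensionality => i; rewrite /vsub /vscal; ring.
by rewrite vnorm_scal Rabs_left; lra.
Qed.

Lemma vdist_tri d (y x z : vec d) : vdist x z <= vdist x y + vdist y z.
Proof.
rewrite /vdist; apply: Rle_trans (vnormD _ _); right; congr vnorm.
by apply: functional_extensionality => i; rewrite /vsub /vadd; lra.
Qed.

Lemma vdist_ge0 d (x y : vec d) : 0 <= vdist x y.
Proof. exact: vnorm_ge0. Qed.

Lemma vdistxx d (x : vec d) : vdist x x = 0.
Proof.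
have := vnorm2 (vsub x x); rewrite !dotE -/(vdist x x); have := vdist_ge0 x x.
nra.
Qed.

Lemma vdist2 d (x y : vec d) : vdist x y * vdist x y = dot (vsub x y) (vsub x y).
Proof. exact: vnorm2. Qed.

Lemma vnorm_dist d (x y : vec d) : vnorm x <= vnorm y + vdist x y.
Proof.
rewrite /vdist; apply: Rle_trans (vnormD _ _); right; congr vnorm.
by apply: functional_extensionality => i; rewrite /vsub /vadd; lra.
Qed.

Lemma coord_le d (x : vec d) i : Rabs (x i) <= vnorm x.
Proof.
apply: Rsqr_incr_0_var (vnorm_ge0 x).
rewrite -Rsqr_abs /Rsqr vnorm2.
by apply: (@rsum_term_le _ (fun i => x i * x i) i) => j; nra.
Qed.

Lemma vnorm_coord d (x : vec d) r : 0 <= r -> (forall i, Rabs (x i) <= r) ->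
  vnorm x <= INR d * r.
Proof.
move=> r0 h; have d0 := pos_INR d.
apply: vnorm_le; first nra.
apply: Rle_trans (_ : INR d * (r * r) <= _).
  rewrite -rsum_const; apply: rsum_le => i.
  have := Rsqr_le_abs_1 (x i) r; rewrite (Rabs_pos_eq r) // /Rsqr.
  by move/(_ (h i)).
case: (Nat.eq_0_gt_0_cases d) => [->|/lt_INR /=] ; first by rewrite /=; lra.
move=> dp.
have: 1 <= INR d by apply: (le_INR 1); apply/leP; move: dp; case: (d) => //=; lra.
nra.
Qed.

Definition mnorm (d m : nat) (s : mat d m) : R := mdist s (fun _ _ => 0).

Lemma mdist_ge0 d m (s s' : mat d m) : 0 <= mdist s s'.
Proof. exact: sqrt_pos. Qed.

Lemma trmul_dist d m (s s' : mat d m) (p : vec d) :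
  vdist (trmul s p) (trmul s' p) <= mdist s s' * vnorm p.
Proof.
have P := vnorm_ge0 p; have M := mdist_ge0 s s'.
apply: vnorm_le; first nra.
have -> : mdist s s' * vnorm p * (mdist s s' * vnorm p)
   = (mdist s s' * mdist s s') * dot p p by rewrite -vnorm2; ring.
rewrite /mdist sqrt_sqrt; last first.
  by apply: rsum_ge0 => i; apply: rsum_ge0 => j; exact: pow2_ge_0.
have -> : rsum (fun i => rsum (fun j => (s i j - s' i j) ^ 2))
  = rsum (fun j => rsum (fun i => (s i j - s' i j) ^ 2)).
  exact: exchange_big.
rewrite Rmult_comm -rsumZ; apply: rsum_le => j.
have -> : vsub (trmul s p) (trmul s' p) j = dot (fun i => s i j - s' i j) p.
  rewrite /vsub /trmul /dot.
  have -> : rsum (fun i => (s i j - s' i j) * p i)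
    = rsum (fun i => s i j * p i + -1 * (s' i j * p i)).
    by congr rsum; apply: functional_extensionality => i; ring.
  by rewrite rsumD rsumZ; ring.
set c : vec d := fun i => s i j - s' i j.
have -> : rsum (fun i => (s i j - s' i j) ^ 2) = dot c c.
  by congr rsum; apply: functional_extensionality => i; rewrite /c; ring.
have h := dot_abs c p; have := Rsqr_le_abs_1 (dot c p) (vnorm c * vnorm p).
rewrite (Rabs_pos_eq (_ * _)); last by have := vnorm_ge0 c; nra.
move=> /(_ h); rewrite /Rsqr -!vnorm2; nra.
Qed.

Lemma trmulD d m (s : mat d m) (p q : vec d) :
  trmul s (vadd p q) = vadd (trmul s p) (trmul s q).
Proof.
apply: functional_extensionality => j; rewrite /vadd /trmul -rsumD.
by congr rsum; apply: functional_extensionality => i; ring.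
Qed.

Lemma trmulZ d m (s : mat d m) a (p : vec d) :
  trmul s (vscal a p) = vscal a (trmul s p).
Proof.
apply: functional_extensionality => j; rewrite /vscal /trmul -rsumZ.
by congr rsum; apply: functional_extensionality => i; ring.
Qed.

Lemma trmul_norm d m (s : mat d m) (p : vec d) :
  vnorm (trmul s p) <= mnorm s * vnorm p.
Proof.
apply: Rle_trans (trmul_dist s (fun _ _ => 0) p).
right; congr vnorm; apply: functional_extensionality => j.
rewrite /vsub /trmul.
have -> : rsum (fun i : 'I_d => 0 * p i) = 0 by rewrite rsumZ; ring.
ring.
Qed.


(** * Compactness and semicontinuity *)

(* Compactness of [K], phrased without sequences: think of [G w x] as the
   statement that [x] is bad up to the tolerance [w]. *)
Definition compact_in (X : Type) (K : X -> Prop) (D : X -> X -> R) : Prop :=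
  forall G : R -> X -> Prop,
    (forall w w' x, w <= w' -> G w x -> G w' x) ->
    (forall w, 0 < w -> exists x, K x /\ G w x) ->
    exists h, K h /\ forall w, 0 < w -> exists x, K x /\ G w x /\ D x h < w.

Definition prod_set (X Y : Type) (K : X -> Prop) (K' : Y -> Prop) (p : X * Y) : Prop :=
  K p.1 /\ K' p.2.

Definition prod_dist (X Y : Type) (D : X -> X -> R) (D' : Y -> Y -> R) (p q : X * Y) : R :=
  Rmax (D p.1 q.1) (D' p.2 q.2).

(** Closeness to the first cluster point becomes part of the badness condition on the second factor,
    so that one pair is close in both coordinates. *)
Lemma compact_prod X Y (K : X -> Prop) (K' : Y -> Prop) D D' :
  compact_in K D -> compact_in K' D' ->
  compact_in (prod_set K K') (prod_dist D D').
Proof.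
move=> cK cK' G mono ex.
have [] := cK (fun w x => exists y, K' y /\ G w (x, y)).
- by move=> w w' x hw [y [Ky Gy]]; exists y; split=> //; apply: mono hw Gy.
- move=> w w0; have [[x y] [[/= Kx Ky] Gxy]] := ex w w0.
  by exists x; split=> //; exists y.
move=> h [Kh near_h].
have [] := cK' (fun w y => exists x, K x /\ G w (x, y) /\ D x h < w).
- move=> w w' y hw [x [Kx [Gx Dx]]]; exists x; split=> //; split; last lra.
  exact: mono hw Gx.
- move=> w w0; have [x [Kx [[y [Ky Gxy]] Dx]]] := near_h w w0.
  by exists y; split=> //; exists x.
move=> h' [Kh' near_h']; exists (h, h'); split=> // w w0.
have [y [Ky [[x [Kx [Gxy Dx]]] Dy]]] := near_h' w w0.
by exists (x, y); split=> //; split=> //; apply: Rmax_lub_lt.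
Qed.

Lemma compact_sub X (K K' : X -> Prop) D :
  compact_in K D -> (forall x, K' x -> K x) ->
  (forall h, K h -> (forall w, 0 < w -> exists x, K' x /\ D x h < w) -> K' h) ->
  compact_in K' D.
Proof.
move=> cK sub closed G mono ex.
have [] := cK (fun w x => K' x /\ G w x).
- by move=> w w' x hw [Kx Gx]; split=> //; apply: mono hw Gx.
- move=> w w0; have [x [Kx Gx]] := ex w w0.
  by exists x; split=> //; apply: sub.
move=> h [Kh near_h]; exists h; split.
  apply: closed => // w w0; have [x [_ [[Kx _] Dx]]] := near_h w w0.
  by exists x.
move=> w w0; have [x [_ [[Kx Gx] Dx]]] := near_h w w0.
by exists x.
Qed.

(** The cluster point is the supremum of the [c] such that [[c, b]] still contains bad points at
    every tolerance. Just left of it bad points persist; to its right some tolerance [w1] has none,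
    and taking the smaller of the two tolerances traps a bad point near it. *)
Lemma compact_itv a b :
  compact_in (fun t => a <= t <= b) (fun s t => Rabs (s - t)).
Proof.
move=> G mono ex.
pose E c := a <= c <= b /\ forall w, 0 < w -> exists t, c <= t <= b /\ G w t.
have ab : a <= b by have [x [? _]] := ex 1 Rlt_0_1; lra.
have Ea : E a by split; [lra | move=> w /ex [x [? ?]]; exists x].
have Eb : is_upper_bound E b by move=> c [? _]; lra.
have [h [hub hlub]] := completeness E (ex_intro _ b Eb) (ex_intro _ a Ea).
have ah : a <= h by apply: hub.
have hb : h <= b by apply: hlub.
exists h; split=> // w w0.
have [c [Ec hc]] : exists c, E c /\ h - w < c.
  apply: NNPP => no; have : h <= h - w; last lra.
  apply: hlub => c Ec; apply: Rnot_lt_le => lt; apply: no; by exists c.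
have [w1 [w10 Gw1]] : exists w1, 0 < w1 /\ forall t, h + w <= t <= b -> ~ G w1 t.
  apply: NNPP => no.
  have hwb : h + w <= b.
    apply: Rnot_lt_le => lt; apply: no; exists 1; split; first lra.
    by move=> t ?; lra.
  have : h + w <= h; last lra.
  apply: hub; split; first lra.
  move=> w1 w10; apply: NNPP => no1; apply: no; exists w1; split=> // t ht Gt.
  by apply: no1; exists t.
have m0 : 0 < Rmin w w1 by apply: Rmin_glb_lt.
have [t [ht Gt]] := Ec.2 _ m0.
exists t; split; first by case: Ec => ?; lra.
split; first by apply: mono Gt; apply: Rmin_l.
have lt : t < h + w.
  apply: Rnot_le_lt => le; apply: (Gw1 t); first lra.
  by apply: mono Gt; apply: Rmin_r.
by apply: Rabs_def1; lra.
Qed.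

(* The coordinates of the cluster point are found one at a time. *)
Lemma compact_clos d (O : vec d -> Prop) :
  is_bounded O -> compact_in (clos O) (@vdist d).
Proof.
move=> [M hM] G mono ex.
have bd x i : clos O x -> - (M + 1) <= x i <= M + 1.
  move=> /(_ 1 Rlt_0_1) [y [Oy xy]].
  have := coord_le x i; have := vnorm_dist x y; have := hM y Oy.
  rewrite vdistC in xy => h1 h2 h3.
  have := Rle_abs (x i); have := Rle_abs (- x i); rewrite Rabs_Ropp; lra.
have step (k : nat) : (k <= d)%nat -> exists h : vec d, forall w, 0 < w ->
    exists x, clos O x /\ G w x /\ forall i : 'I_d, (i < k)%nat -> Rabs (x i - h i) < w.
  elim: k => [|k IH] kd.
    by exists (fun _ => 0) => w w0; have [x [Kx Gx]] := ex w w0; exists x.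
  have [h near_h] := IH (ltnW kd).
  pose k0 := Ordinal kd.
  have [] := @compact_itv (- (M + 1)) (M + 1) (fun w c => exists x, clos O x /\ G w x /\
     (forall i : 'I_d, (i < k)%nat -> Rabs (x i - h i) < w) /\ x k0 = c).
  - move=> w w' c hw [x [Kx [Gx [hx xc]]]]; exists x; split=> //.
    split; first exact: mono hw Gx.
    by split=> // i ik; have := hx i ik; lra.
  - move=> w w0; have [x [Kx [Gx hx]]] := near_h w w0.
    by exists (x k0); split; [exact: bd | exists x].
  move=> c [_ near_c].
  exists (fun i : 'I_d => if (i : nat) == k then c else h i) => w w0.
  have [_ [_ [[x [Kx [Gx [hx <-]]]] xc]]] := near_c w w0.
  exists x; split=> //; split=> // i; rewrite ltnS leq_eqVlt.
  case: eqP => [ik _|_ /= ik]; last exact: hx.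
  by have -> : i = k0 by apply: val_inj.
have [h near_h] := step d (leqnn d).
have near w : 0 < w -> exists x, clos O x /\ G w x /\ vdist x h < w.
  move=> w0; have d0 := pos_INR d.
  have w1 : 0 < w / (INR d + 1) by apply: Rdiv_lt_0_compat; lra.
  have [x [Kx [Gx hx]]] := near_h _ w1.
  have le : w / (INR d + 1) * (INR d + 1) = w by field; lra.
  exists x; split=> //; split; first by apply: mono Gx; nra.
  apply: Rle_lt_trans (_ : INR d * (w / (INR d + 1)) < _); last nra.
  apply: vnorm_coord; first lra.
  by move=> i; apply: Rlt_le; apply: hx; apply: ltn_ord.
exists h; split=> // r r0.
have r2 : 0 < r / 2 by lra.
have [x [Kx [_ xh]]] := near _ r2.
have [y [Oy yx]] := Kx _ r2.
by exists y; split=> //; have := vdist_tri x y h; lra.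
Qed.

Definition usc_at (X : Type) (K : X -> Prop) (D : X -> X -> R) (F : X -> R) (h : X) : Prop :=
  forall e, 0 < e -> exists w, 0 < w /\ forall x, K x -> D x h < w -> F x < F h + e.

Lemma compact_bound X (K : X -> Prop) D (P : R -> X -> Prop) :
  compact_in K D -> (forall B B' x, B <= B' -> P B x -> P B' x) ->
  (forall h, K h -> exists B w, 0 < w /\ forall x, K x -> D x h < w -> P B x) ->
  exists B, 0 <= B /\ forall x, K x -> P B x.
Proof.
move=> cK mono loc; apply: NNPP => no.
(* The tolerance [w] encodes the bound [1 / w]: a point is bad when [P B] fails for every [B] up to
   [1 / w]. A cluster point of bad points contradicts the local bound there. *)
have [] := cK (fun w x => forall B, 0 <= B -> B * w <= 1 -> ~ P B x).
- by move=> w w' x hw Gx B B0 hB; apply: Gx => //; nra.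
- move=> w w0; apply: NNPP => no1; apply: no; exists (/ w); split.
    by apply: Rlt_le; apply: Rinv_0_lt_compat.
  move=> x Kx; apply: NNPP => nP; apply: no1; exists x; split=> // B B0 hB PB.
  apply: nP; apply: mono PB; apply: (Rmult_le_reg_r w) => //.
  by rewrite Rinv_l; lra.
move=> h [Kh near_h]; have [B [w [w0 hw]]] := loc h Kh.
have B0 := Rabs_pos B; have iB : 0 < / (Rabs B + 1) by apply: Rinv_0_lt_compat; lra.
have [x [Kx [Gx Dx]]] := near_h _ (Rmin_glb_lt _ _ _ w0 iB).
have l1 := Rmin_l w (/ (Rabs B + 1)); have l2 := Rmin_r w (/ (Rabs B + 1)).
apply: (Gx (Rabs B + 1)); first lra.
  apply: Rle_trans (_ : (Rabs B + 1) * / (Rabs B + 1) <= _); first by apply: Rmult_le_compat_l; lra.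
  by rewrite Rinv_r; lra.
by apply: mono (hw x Kx _); [have := Rle_abs B; lra | lra].
Qed.

(** Heine-Cantor for a relation instead of a distance: [E e] may then quantify over all vectors to
    which the matrix is applied, and treat drift and diffusion at once. *)
Lemma compact_unif X (K : X -> Prop) D (E : R -> X -> X -> Prop) :
  compact_in K D -> (forall p q h, D p h <= D p q + D q h) -> (forall p q, D p q = D q p) ->
  (forall e p q h, E (e / 2) p h -> E (e / 2) q h -> E e p q) ->
  (forall h, K h -> forall e, 0 < e -> exists w, 0 < w /\ forall x, K x -> D x h < w -> E e x h) ->
  forall e, 0 < e -> exists w, 0 < w /\ forall p q, K p -> K q -> D p q < w -> E e p q.
Proof.
move=> cK Dtri Dsym Etri loc e e0; apply: NNPP => no.
have [] := cK (fun w p => exists q, K q /\ D p q < w /\ ~ E e p q).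
- by move=> w w' p hw [q [Kq [Dq nE]]]; exists q; split=> //; split=> //; lra.
- move=> w w0; apply: NNPP => no1; apply: no; exists w; split=> // p q Kp Kq Dpq.
  by apply: NNPP => nE; apply: no1; exists p; split=> //; exists q.
move=> h [Kh near_h]; have [w [w0 hw]] := loc h Kh (e / 2) ltac:(lra).
have [p [Kp [[q [Kq [Dpq nE]]] Dph]]] := near_h (w / 2) ltac:(lra).
apply: nE; apply: (Etri _ _ _ h); apply: hw => //; first lra.
by have := Dtri q p h; rewrite (Dsym q p); lra.
Qed.

Lemma usc_max X (K : X -> Prop) D F :
  compact_in K D -> (forall h, K h -> usc_at K D F h) -> (exists x, K x) ->
  exists h, K h /\ forall x, K x -> F x <= F h.
Proof.
move=> cK usc [x0 Kx0].
have [B [_ hB]] : exists B, 0 <= B /\ forall x, K x -> F x <= B.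
  apply: (compact_bound cK) => [B B' x|h Kh]; first lra.
  have [w [w0 hw]] := usc h Kh 1 Rlt_0_1; exists (F h + 1), w; split=> // x Kx Dx.
  by apply: Rlt_le; apply: hw.
have [S [Sub Slub]] := completeness (fun c => exists x, K x /\ c = F x)
  (ex_intro _ B (fun c hc => let: ex_intro x (conj Kx e) := hc in eq_ind_r (fun c => c <= B) (hB x Kx) e))
  (ex_intro _ _ (ex_intro _ x0 (conj Kx0 erefl))).
have [] := cK (fun w x => S - w < F x).
- by move=> w w' x hw; lra.
- move=> w w0; apply: NNPP => no; have : S <= S - w; last lra.
  apply: Slub => _ [x [Kx ->]]; apply: Rnot_lt_le => lt; apply: no.
  by exists x.
move=> h [Kh near_h]; exists h; split=> // x Kx.
apply: Rle_trans (_ : S <= _); first by apply: Sub; exists x.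
apply: le_epsilon => e e0; have e2 : 0 < e / 2 by lra.
have [w [w0 hw]] := usc h Kh _ e2.
have m0 : 0 < Rmin w (e / 2) by apply: Rmin_glb_lt.
have [y [Ky [Gy Dy]]] := near_h _ m0.
have l1 := Rmin_l w (e / 2); have l2 := Rmin_r w (e / 2).
have := hw y Ky; lra.
Qed.

Lemma usc_add X (K : X -> Prop) D F F' h :
  usc_at K D F h -> usc_at K D F' h -> usc_at K D (fun x => F x + F' x) h.
Proof.
move=> uF uF' e e0; have e2 : 0 < e / 2 by lra.
have [w [w0 hw]] := uF _ e2; have [w' [w'0 hw']] := uF' _ e2.
exists (Rmin w w'); split; first exact: Rmin_glb_lt.
move=> x Kx Dx; have l1 := Rmin_l w w'; have l2 := Rmin_r w w'.
have := hw x Kx; have := hw' x Kx; lra.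
Qed.

Lemma usc_scal X (K : X -> Prop) D F a h :
  0 < a -> usc_at K D F h -> usc_at K D (fun x => a * F x) h.
Proof.
move=> a0 uF e e0; have e1 : 0 < e / a by apply: Rdiv_lt_0_compat.
have [w [w0 hw]] := uF _ e1; exists w; split=> // x Kx Dx.
have := hw x Kx Dx; have : a * (e / a) = e by field; lra.
nra.
Qed.

Lemma usc_lip X (K : X -> Prop) D F C h :
  (forall x, K x -> F x - F h <= C * D x h) -> (forall x, 0 <= D x h) ->
  usc_at K D F h.
Proof.
move=> lip D0 e e0; have C1 : 0 < Rabs C + 1 by have := Rabs_pos C; lra.
exists (e / (Rabs C + 1)); split; first exact: Rdiv_lt_0_compat.
move=> x Kx Dx; have := lip x Kx; have := Rle_abs C; have := D0 x.
have : e / (Rabs C + 1) * (Rabs C + 1) = e by field; lra.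
nra.
Qed.


(** * Test functions *)

(** The quadratic remainder and the Lipschitz gradient are kept together with one global constant:
    both pass to sums and multiples by algebra, so that calculus enters only in [C11_of_grad]. *)
Definition C11 (d : nat) (f : vec d -> R) (Df : vec d -> vec d) : Prop :=
  exists C, 0 <= C /\ forall x y,
    Rabs (f y - f x - dot (Df x) (vsub y x)) <= C * (vdist y x * vdist y x) /\
    vdist (Df y) (Df x) <= C * vdist y x.

Lemma C11_add d (f g : vec d -> R) Df Dg : C11 f Df -> C11 g Dg ->
  C11 (fun x => f x + g x) (fun x => vadd (Df x) (Dg x)).
Proof.
move=> [C [C0 hf]] [C' [C'0 hg]]; exists (C + C'); split; first lra.
move=> x y; have [f1 f2] := hf x y; have [g1 g2] := hg x y; split.
  have -> : f y + g y - (f x + g x) - dot (vadd (Df x) (Dg x)) (vsub y x)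
    = (f y - f x - dot (Df x) (vsub y x)) + (g y - g x - dot (Dg x) (vsub y x)).
    by rewrite dotDl; ring.
  have := Rabs_triang (f y - f x - dot (Df x) (vsub y x)) (g y - g x - dot (Dg x) (vsub y x)).
  lra.
rewrite /vdist in f2 g2 *.
have -> : vsub (vadd (Df y) (Dg y)) (vadd (Df x) (Dg x))
  = vadd (vsub (Df y) (Df x)) (vsub (Dg y) (Dg x)).
  by apply: functional_extensionality => i; rewrite /vsub /vadd; ring.
apply: Rle_trans (vnormD _ _) _; lra.
Qed.

Lemma vdist_scal d a (x y : vec d) : vdist (vscal a x) (vscal a y) = Rabs a * vdist x y.
Proof.
rewrite /vdist -vnorm_scal; congr vnorm.
by apply: functional_extensionality => i; rewrite /vsub /vscal; ring.
Qed.

Lemma C11_scal d (f : vec d -> R) Df a : C11 f Df ->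
  C11 (fun x => a * f x) (fun x => vscal a (Df x)).
Proof.
move=> [C [C0 hf]]; exists (Rabs a * C); have A := Rabs_pos a; split; first nra.
move=> x y; have [f1 f2] := hf x y; split.
  rewrite dotZl.
  have -> : a * f y - a * f x - a * dot (Df x) (vsub y x)
    = a * (f y - f x - dot (Df x) (vsub y x)) by ring.
  rewrite Rabs_mult; nra.
rewrite vdist_scal; nra.
Qed.

Definition sym_op (d : nat) (S : vec d -> vec d) (C : R) : Prop :=
  (forall x y, S (vadd x y) = vadd (S x) (S y)) /\
  (forall a x, S (vscal a x) = vscal a (S x)) /\
  (forall x y, dot (S x) y = dot (S y) x) /\
  (forall x, vnorm (S x) <= C * vnorm x).

Lemma sym_op_id d : sym_op (fun x : vec d => x) 1.
Proof. by split=> //; split=> //; split=> [x y|x]; [rewrite dotC | lra]. Qed.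

Lemma sym_opB d (S : vec d -> vec d) C x y : sym_op S C -> S (vsub x y) = vsub (S x) (S y).
Proof. by move=> [SD [SZ _]]; rewrite !vsubE SD SZ. Qed.

Lemma C11_quad d (S : vec d -> vec d) C z : 0 <= C -> sym_op S C ->
  C11 (fun x => dot (S (vsub x z)) (vsub x z)) (fun x => vscal 2 (S (vsub x z))).
Proof.
move=> C0 symS; have [SD [SZ [Ssym Sbd]]] := symS.
exists (2 * C); split; first lra.
move=> x y; split.
  have -> : dot (S (vsub y z)) (vsub y z) - dot (S (vsub x z)) (vsub x z)
    - dot (vscal 2 (S (vsub x z))) (vsub y x) = dot (S (vsub y x)) (vsub y x).
    rewrite !(sym_opB _ _ symS) !dotE.
    have := Ssym x y; have := Ssym x z; have := Ssym y z; lra.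
  apply: Rle_trans (dot_abs _ _) _.
  have := Sbd (vsub y x); rewrite -/(vdist y x); have := vdist_ge0 y x; nra.
rewrite vdist_scal Rabs_pos_eq; last lra.
have -> : vdist (S (vsub y z)) (S (vsub x z)) = vnorm (S (vsub y x)).
  rewrite /vdist -(sym_opB _ _ symS); congr (vnorm (S _)).
  by apply: functional_extensionality => i; rewrite /vsub; ring.
have := Sbd (vsub y x); rewrite -/(vdist y x); lra.
Qed.

(** The mean value theorem on the segment from [x] to [y] replaces the increment by the gradient at
    an intermediate point, whose distance to [x] is at most that of [y]. *)
Lemma C11_of_grad d (f : vec d -> R) Df L : has_grad f Df ->
  (forall x y, vdist (Df x) (Df y) <= L * vdist x y) -> C11 f Df.
Proof.
move=> grad lip; exists (Rabs L); split; first exact: Rabs_pos.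
have lip' x y : vdist (Df x) (Df y) <= Rabs L * vdist x y.
  by have := lip x y; have := Rle_abs L; have := vdist_ge0 x y; nra.
move=> x y; split; last exact: lip'.
pose h := vsub y x; pose p t := vadd x (vscal t h).
have dp s t : vsub (p s) (p t) = vscal (s - t) h.
  by apply: functional_extensionality => i; rewrite /p /h /vsub /vadd /vscal; ring.
have deriv t : derivable_pt_lim (fun t => f (p t)) t (dot (Df (p t)) h).
  move=> eps eps0.
  have H1 : 0 < vnorm h + 1 by have := vnorm_ge0 h; lra.
  have e1 : 0 < eps / (2 * (vnorm h + 1)) by apply: Rdiv_lt_0_compat; lra.
  have [dl [dl0 hdl]] := grad (p t) _ e1.
  have d1 : 0 < dl / (vnorm h + 1) by apply: Rdiv_lt_0_compat.
  exists (mkposreal _ d1) => k k0 /= kd.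
  have pk : vsub (p (t + k)) (p t) = vscal k h.
    by rewrite dp; congr vscal; ring.
  have dk : vdist (p (t + k)) (p t) = Rabs k * vnorm h by rewrite /vdist pk vnorm_scal.
  have kp := Rabs_pos_lt k k0.
  have hn := vnorm_ge0 h.
  have dd : dl / (vnorm h + 1) * (vnorm h + 1) = dl by field; lra.
  have := hdl (p (t + k)); rewrite dk pk dotZr => H.
  have {}H := H ltac:(nra).
  have -> : (f (p (t + k)) - f (p t)) / k - dot (Df (p t)) h
    = (f (p (t + k)) - f (p t) - k * dot (Df (p t)) h) / k by field.
  rewrite /Rdiv Rabs_mult Rabs_inv; apply: (Rmult_lt_reg_r (Rabs k)) => //.
  have -> : Rabs (f (p (t + k)) - f (p t) - k * dot (Df (p t)) h) / Rabs k * Rabs k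
    = Rabs (f (p (t + k)) - f (p t) - k * dot (Df (p t)) h) by field; lra.
  apply: Rle_lt_trans H _.
  have ee : eps / (2 * (vnorm h + 1)) * (vnorm h + 1) = eps / 2 by field; lra.
  nra.
have [c [hc [c0 c1]]] := MVT_cor2 (fun t => f (p t)) (fun t => dot (Df (p t)) h) 0 1
  Rlt_0_1 (fun t _ => deriv t).
have p0 : p 0 = x by apply: functional_extensionality => i; rewrite /p /vadd /vscal; ring.
have p1 : p 1 = y by apply: functional_extensionality => i; rewrite /p /h /vadd /vscal /vsub; ring.
rewrite p0 p1 in hc; rewrite hc -/h.
have -> : dot (Df (p c)) h * (1 - 0) - dot (Df x) h = dot (vsub (Df (p c)) (Df x)) h.
  by rewrite !dotE; ring.
apply: Rle_trans (dot_abs _ _) _.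
rewrite -/(vdist _ _); have := lip' (p c) x.
have -> : vdist (p c) x = c * vdist y x.
  by rewrite -{1}p0 /vdist dp vnorm_scal Rabs_pos_eq; [rewrite -/h; ring | lra].
rewrite -/(vdist y x); have := vdist_ge0 y x; have := Rabs_pos L => L0 D0 hh.
have : Rabs L * (c * vdist y x) <= Rabs L * vdist y x.
  by apply: Rmult_le_compat_l => //; nra.
have := vdist_ge0 (Df (p c)) (Df x); nra.
Qed.

(** This time profile covers every test function of the proof: slope [- K] alone for the terminal
    bound, weight [l / lam] centred at [s] with slope [- beta / lam] for [u], weight [- l] centred
    at [t] for [v]. *)
Lemma C1_test d (f : vec d -> R) Df k s0 k' : C11 f Df ->
  Defs.C1 (fun t x => k * ((t - s0) * (t - s0)) + k' * t + f x)
     (fun t _ => 2 * k * (t - s0) + k') (fun _ x => Df x).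
Proof.
move=> [C [C0 hf]]; have K := Rabs_pos k; split=> t x eps e0.
  have D1 : 0 < C + Rabs k + 1 by lra.
  exists (eps / (C + Rabs k + 1)); split; first exact: Rdiv_lt_0_compat.
  move=> s y hs hy; have [hfy _] := hf x y.
  have -> : k * ((s - s0) * (s - s0)) + k' * s + f y
    - (k * ((t - s0) * (t - s0)) + k' * t + f x) - (2 * k * (t - s0) + k') * (s - t)
    - dot (Df x) (vsub y x)
    = k * ((s - t) * (s - t)) + (f y - f x - dot (Df x) (vsub y x)) by ring.
  apply: Rle_trans (Rabs_triang _ _) _.
  rewrite !Rabs_mult.
  have e : eps / (C + Rabs k + 1) * (C + Rabs k + 1) = eps by field; lra.
  have q0 : 0 < eps / (C + Rabs k + 1) by exact: Rdiv_lt_0_compat.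
  set q := eps / _ in e q0 hs hy.
  have y0 := vdist_ge0 y x; have st0 := Rabs_pos (s - t).
  set D := vdist y x in y0 hy hfy *; set S := Rabs (s - t) in st0 hs *.
  have a1 : C * (D * D) <= C * (q * D) by apply: Rmult_le_compat_l => //; nra.
  have a2 : Rabs k * (S * S) <= Rabs k * (q * S) by apply: Rmult_le_compat_l => //; nra.
  have b1 : C * q <= eps by nra.
  have b2 : Rabs k * q <= eps by nra.
  have b1' : C * q * D <= eps * D by apply: Rmult_le_compat_r.
  have b2' : Rabs k * q * S <= eps * S by apply: Rmult_le_compat_r.
  lra.
have D1 : 0 < C + 2 * Rabs k + 1 by lra.
exists (eps / (C + 2 * Rabs k + 1)); split; first exact: Rdiv_lt_0_compat.
have e : eps / (C + 2 * Rabs k + 1) * (C + 2 * Rabs k + 1) = eps by field; lra.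
have q0 : 0 < eps / (C + 2 * Rabs k + 1) by exact: Rdiv_lt_0_compat.
set q := eps / _ in e q0 *.
move=> s y hs hy; have [_ hfy] := hf x y; split.
  have -> : 2 * k * (s - s0) + k' - (2 * k * (t - s0) + k') = 2 * k * (s - t) by ring.
  rewrite !Rabs_mult (Rabs_pos_eq 2); last lra.
  have := Rabs_pos (s - t); nra.
have := vdist_ge0 y x; nra.
Qed.


(** * Bounded Lipschitz fields *)

Definition bl_scalar (d : nat) (K : vec d -> Prop) (s : vec d -> R) : Prop :=
  exists C, 0 <= C /\ (forall x, K x -> Rabs (s x) <= C) /\
    forall x y, K x -> K y -> Rabs (s x - s y) <= C * vdist x y.

Definition bl_vec (d : nat) (K : vec d -> Prop) (f : vec d -> vec d) : Prop :=
  exists C, 0 <= C /\ (forall x, K x -> vnorm (f x) <= C) /\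
    forall x y, K x -> K y -> vdist (f x) (f y) <= C * vdist x y.

Definition bl_op (d : nat) (K : vec d -> Prop) (S : vec d -> vec d -> vec d) : Prop :=
  exists C, 0 <= C /\ (forall z xi, K z -> vnorm (S z xi) <= C * vnorm xi) /\
    forall z z' xi, K z -> K z' -> vdist (S z xi) (S z' xi) <= C * vdist z z' * vnorm xi.

Lemma bl_dot d (K : vec d -> Prop) f g : bl_vec K f -> bl_vec K g ->
  bl_scalar K (fun x => dot (f x) (g x)).
Proof.
move=> [C [C0 [bf lf]]] [C' [C'0 [bg lg]]].
exists (C * C' + C' * C); split; first nra; split=> [x Kx|x y Kx Ky].
  apply: Rle_trans (dot_abs _ _) _.
  have := bf x Kx; have := bg x Kx; have := vnorm_ge0 (f x); have := vnorm_ge0 (g x).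
  have : 0 <= C * C' by nra.
  nra.
have -> : dot (f x) (g x) - dot (f y) (g y)
  = dot (vsub (f x) (f y)) (g x) + dot (f y) (vsub (g x) (g y)) by rewrite !dotE; ring.
apply: Rle_trans (Rabs_triang _ _) _.
have h1 := dot_abs (vsub (f x) (f y)) (g x).
have h2 := dot_abs (f y) (vsub (g x) (g y)).
rewrite -/(vdist (f x) (f y)) in h1; rewrite -/(vdist (g x) (g y)) in h2.
have := lf x y Kx Ky; have := lg x y Kx Ky; have := bg x Kx; have := bf y Ky.
have := vdist_ge0 (f x) (f y); have := vdist_ge0 (g x) (g y).
have := vnorm_ge0 (f y); have := vnorm_ge0 (g x); have := vdist_ge0 x y.
set a := vdist (f x) (f y) in h1 *; set b := vdist (g x) (g y) in h2 *.
set e := vnorm (f y) in h2 *; set f' := vnorm (g x) in h1 *; set D := vdist x y.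
move=> D0 f0 e0 b0 a0 eC fC bD aD.
have k1 : a * f' <= C * D * C' by apply: Rmult_le_compat.
have k2 : e * b <= C * (C' * D) by apply: Rmult_le_compat.
lra.
Qed.

Lemma bl_scal d (K : vec d -> Prop) s f : bl_scalar K s -> bl_vec K f ->
  bl_vec K (fun x => vscal (s x) (f x)).
Proof.
move=> [C [C0 [bf lf]]] [C' [C'0 [bg lg]]].
exists (C * C' + C' * C); split; first nra; split=> [x Kx|x y Kx Ky].
  rewrite vnorm_scal.
  have := bf x Kx; have := bg x Kx; have := Rabs_pos (s x); have := vnorm_ge0 (f x).
  have : 0 <= C * C' by nra.
  nra.
rewrite /vdist.
have -> : vsub (vscal (s x) (f x)) (vscal (s y) (f y))
  = vadd (vscal (s x - s y) (f x)) (vscal (s y) (vsub (f x) (f y))).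
  by apply: functional_extensionality => i; rewrite /vsub /vadd /vscal; ring.
apply: Rle_trans (vnormD _ _) _; rewrite !vnorm_scal -/(vdist (f x) (f y)) -/(vdist x y).
have k1 : Rabs (s x - s y) * vnorm (f x) <= C * vdist x y * C'.
  by apply: Rmult_le_compat; [exact: Rabs_pos|exact: vnorm_ge0|exact: lf|exact: bg].
have k2 : Rabs (s y) * vdist (f x) (f y) <= C * (C' * vdist x y).
  by apply: Rmult_le_compat; [exact: Rabs_pos|exact: vnorm_ge0|exact: bf|exact: lg].
lra.
Qed.

(** The floor [c] is there because the scalar to be inverted, the product of gradient and [gamma],
    is bounded below only on the boundary, while its inverse must be Lipschitz on the whole
    closure. *)
Lemma bl_inv d (K : vec d -> Prop) s c : 0 < c -> bl_scalar K s ->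
  bl_scalar K (fun x => / Rmax (s x) c).
Proof.
move=> c0 [C [C0 [_ lf]]].
have ic := Rinv_0_lt_compat c c0.
have pos x : c <= Rmax (s x) c by exact: Rmax_r.
have inv0 x : 0 < / Rmax (s x) c by apply: Rinv_0_lt_compat; have := pos x; lra.
have invc x : / Rmax (s x) c <= / c by apply: Rinv_le_contravar.
have lip x y : K x -> K y -> Rabs (Rmax (s x) c - Rmax (s y) c) <= C * vdist x y.
  move=> Kx Ky; apply: Rle_trans (lf x y Kx Ky).
  have q := Rle_abs (s x - s y); have q' := Rle_abs (- (s x - s y)).
  rewrite Rabs_Ropp in q'; apply: Rabs_le.
  rewrite /Rmax; case: (Rle_dec (s x) c) => [h1|/Rnot_le_lt h1];
    case: (Rle_dec (s y) c) => [h2|/Rnot_le_lt h2]; lra.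
have ic2 : 0 <= / c * / c by nra.
exists (/ c + / c * / c * C); split; first nra.
split=> [x Kx|x y Kx Ky].
  rewrite Rabs_pos_eq; last exact: Rlt_le.
  by have := invc x; nra.
have -> : / Rmax (s x) c - / Rmax (s y) c
  = / Rmax (s x) c * / Rmax (s y) c * (Rmax (s y) c - Rmax (s x) c).
  by field; have := pos x; have := pos y; lra.
rewrite !Rabs_mult !(Rabs_pos_eq (/ _)); try exact: Rlt_le.
have h := lip y x Ky Kx; rewrite vdistC in h.
have k1 : / Rmax (s x) c * / Rmax (s y) c <= / c * / c.
  by apply: Rmult_le_compat => //; apply: Rlt_le.
have k2 : / Rmax (s x) c * / Rmax (s y) c * Rabs (Rmax (s y) c - Rmax (s x) c)
  <= / c * / c * (C * vdist x y).
  apply: Rmult_le_compat => //; last exact: Rabs_pos.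
  by apply: Rmult_le_pos; apply: Rlt_le.
have := vdist_ge0 x y; nra.
Qed.

Lemma bl_op_id d (K : vec d -> Prop) : bl_op K (fun _ xi => xi).
Proof.
exists 1; split; first lra; split=> [z xi _|z z' xi _ _]; first lra.
by rewrite vdistxx; have := vdist_ge0 z z'; have := vnorm_ge0 xi; nra.
Qed.

Lemma bl_op_add d (K : vec d -> Prop) S S' : bl_op K S -> bl_op K S' ->
  bl_op K (fun z xi => vadd (S z xi) (S' z xi)).
Proof.
move=> [C [C0 [bf lf]]] [C' [C'0 [bg lg]]].
exists (C + C'); split; first lra; split=> [z xi Kz|z z' xi Kz Kz'].
  by apply: Rle_trans (vnormD _ _) _; have := bf z xi Kz; have := bg z xi Kz; lra.
rewrite {1}/vdist.
have -> : vsub (vadd (S z xi) (S' z xi)) (vadd (S z' xi) (S' z' xi))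
  = vadd (vsub (S z xi) (S z' xi)) (vsub (S' z xi) (S' z' xi)).
  by apply: functional_extensionality => i; rewrite /vsub /vadd; ring.
apply: Rle_trans (vnormD _ _) _; rewrite -/(vdist (S z xi) (S z' xi)) -/(vdist (S' z xi) (S' z' xi)).
by have := lf z z' xi Kz Kz'; have := lg z z' xi Kz Kz'; lra.
Qed.

Lemma bl_op_rank1 d (K : vec d -> Prop) a b k : bl_vec K a -> bl_vec K b ->
  bl_op K (fun z xi => vscal (k * dot (a z) xi) (b z)).
Proof.
move=> [C [C0 [bf lf]]] [C' [C'0 [bg lg]]].
have k0 := Rabs_pos k; have CC : 0 <= C * C' by nra.
have rank1 (u w xi : vec d) M M' : vnorm u <= M -> vnorm w <= M' ->
  vnorm (vscal (k * dot u xi) w) <= Rabs k * (M * M') * vnorm xi.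
  move=> hu hw; rewrite vnorm_scal Rabs_mult.
  have x0 := vnorm_ge0 xi; have u0 := vnorm_ge0 u; have w0 := vnorm_ge0 w.
  have h : Rabs (dot u xi) <= M * vnorm xi.
    by apply: Rle_trans (dot_abs _ _) _; apply: Rmult_le_compat_r.
  have h' : Rabs (dot u xi) * vnorm w <= M * vnorm xi * M'.
    by apply: Rmult_le_compat => //; exact: Rabs_pos.
  nra.
exists (Rabs k * (2 * (C * C'))); split; first nra.
split=> [z xi Kz|z z' xi Kz Kz'].
  apply: Rle_trans (rank1 _ _ _ C C' _ _) _; [exact: bf|exact: bg|].
  by apply: Rmult_le_compat_r; [exact: vnorm_ge0|nra].
rewrite {1}/vdist.
have -> : vsub (vscal (k * dot (a z) xi) (b z)) (vscal (k * dot (a z') xi) (b z'))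
  = vadd (vscal (k * dot (vsub (a z) (a z')) xi) (b z)) (vscal (k * dot (a z') xi) (vsub (b z) (b z'))).
  by apply: functional_extensionality => i; rewrite dotBl /vsub /vadd /vscal; ring.
apply: Rle_trans (vnormD _ _) _.
have h1 := rank1 (vsub (a z) (a z')) (b z) xi _ _ (lf _ _ Kz Kz') (bg _ Kz).
have h2 := rank1 (a z') (vsub (b z) (b z')) xi _ _ (bf _ Kz') (lg _ _ Kz Kz').
lra.
Qed.


(** * The oblique frame *)

(* [A z] plays the role of a metric for which [gamma z] is normal to the
   boundary; [fr_bd] is what makes the penalty [A z (x - y) . (x - y)]
   compatible with the oblique boundary condition. *)
Record oblique_frame (d : nat) (O : vec d -> Prop) (gamma : vec d -> vec d)
  (rho : vec d -> R) (N : vec d -> vec d) (A : vec d -> vec d -> vec d) (C c : R) : Prop := {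
  fr_C : 1 <= C;
  fr_c : 0 < c;
  fr_C11 : C11 rho N;
  fr_sym : forall z, clos O z -> sym_op (A z) C;
  fr_coer : forall z xi, clos O z -> dot xi xi <= C * dot (A z xi) xi;
  fr_lip : forall z z' xi, clos O z -> clos O z' ->
    vdist (A z xi) (A z' xi) <= C * vdist z z' * vnorm xi;
  fr_bd : forall x y z, bdry O x -> clos O y -> clos O z ->
    - C * (vdist x y * vdist x y + vdist x z * vdist x y) <= dot (A z (vsub x y)) (gamma x);
  fr_N : forall x, bdry O x -> c <= dot (N x) (gamma x);
  fr_rho : forall x, clos O x -> Rabs (rho x) <= C;
  fr_rho_lip : forall x y, clos O x -> clos O y -> Rabs (rho x - rho y) <= C * vdist x y;
  fr_N_bd : forall x, clos O x -> vnorm (N x) <= C;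
  fr_gamma : forall x, clos O x -> vnorm (gamma x) <= C;
  fr_diam : forall x y, clos O x -> clos O y -> vdist x y <= C
}.

Lemma open_bdry_closed d (O : vec d -> Prop) h : is_open O -> clos O h ->
  (forall w, 0 < w -> exists x, bdry O x /\ vdist x h < w) -> bdry O h.
Proof.
move=> opn ch near_h; split=> // Oh; have [r [r0 hr]] := opn h Oh.
by have [x [[_ nOx] xh]] := near_h r r0; apply: nOx; apply: hr.
Qed.

Lemma clos_bounded d (O : vec d -> Prop) : is_bounded O ->
  exists B, 0 <= B /\ forall x, clos O x -> vnorm x <= B.
Proof.
move=> [M hM]; exists (Rabs M + 1); split; first by have := Rabs_pos M; lra.
move=> x /(_ 1 Rlt_0_1) [y [Oy yx]]; rewrite vdistC in yx.
by have := vnorm_dist x y; have := hM y Oy; have := Rle_abs M; lra.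
Qed.

Lemma lip_bl d (O : vec d -> Prop) f L : is_bounded O ->
  (forall x y, vdist (f x) (f y) <= L * vdist x y) -> bl_vec (clos O) f.
Proof.
move=> /clos_bounded [B [B0 hB]] lip.
pose o : vec d := fun _ => 0; have f0 := vnorm_ge0 (f o); have L0 := Rabs_pos L.
have LB : 0 <= Rabs L * (B + vnorm o) by have := vnorm_ge0 o; nra.
exists (vnorm (f o) + Rabs L * (B + vnorm o) + Rabs L); split; first lra.
have lip' x y : vdist (f x) (f y) <= Rabs L * vdist x y.
  by have := lip x y; have := Rle_abs L; have := vdist_ge0 x y; nra.
split=> [x cx|x y _ _]; last first.
  by have := lip' x y; have := vdist_ge0 x y; nra.
have := vnorm_dist (f x) (f o); have := lip' x o; have := vnormB x o.
rewrite -/(vdist x o); have := hB x cx; nra.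
Qed.

Lemma C11_bl d (O : vec d -> Prop) f Df L : is_bounded O -> C11 f Df ->
  (forall x y, vdist (Df x) (Df y) <= L * vdist x y) -> bl_scalar (clos O) f.
Proof.
move=> bO [C [C0 hf]] lip.
have [B [B0 hB]] := clos_bounded bO.
have [C' [C'0 [hD _]]] := lip_bl bO lip.
pose o : vec d := fun _ => 0.
have loc x y : clos O x -> Rabs (f x - f y) <= C' * vdist x y + C * (vdist x y * vdist x y).
  move=> cx; have [h _] := hf x y; have h2 := dot_abs (Df x) (vsub y x).
  rewrite -/(vdist y x) in h2; rewrite vdistC (Rabs_minus_sym (f x)).
  have -> : f y - f x = (f y - f x - dot (Df x) (vsub y x)) + dot (Df x) (vsub y x) by ring.
  apply: Rle_trans (Rabs_triang _ _) _.
  have := hD x cx; have := vdist_ge0 y x; nra.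
pose D := B + B + vnorm o; have o0 := vnorm_ge0 o.
have dxo x : clos O x -> vdist x o <= D.
  by move=> cx; have := vnormB x o; have := hB x cx; rewrite /vdist /D; lra.
have dxy x y : clos O x -> clos O y -> vdist x y <= D.
  by move=> cx cy; have := vnormB x y; have := hB x cx; have := hB y cy; rewrite /vdist /D; lra.
have D0 : 0 <= D by rewrite /D; lra.
have a1 : 0 <= C' * D by nra.
have a2 : 0 <= C * (D * D) by apply: Rmult_le_pos => //; nra.
have a3 : 0 <= C * D by nra.
have a4 := Rabs_pos (f o).
exists (C' + C * D + Rabs (f o) + C' * D + C * (D * D)); split; first lra.
split=> [x cx|x y cx cy].
  have -> : f x = (f x - f o) + f o by ring.
  apply: Rle_trans (Rabs_triang _ _) _.
  have := loc x o cx; have := dxo x cx; have := vdist_ge0 x o => t0 tD.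
  have k1 : C' * vdist x o <= C' * D by apply: Rmult_le_compat_l.
  have k2 : C * (vdist x o * vdist x o) <= C * (D * D).
    by apply: Rmult_le_compat_l => //; apply: Rmult_le_compat.
  lra.
apply: Rle_trans (loc x y cx) _.
have := dxy x y cx cy; have t0 := vdist_ge0 x y => tD.
have k2 : C * (vdist x y * vdist x y) <= C * D * vdist x y.
  by rewrite Rmult_assoc; apply: Rmult_le_compat_l => //; apply: Rmult_le_compat_r.
have k3 : 0 <= (Rabs (f o) + C' * D + C * (D * D)) * vdist x y by apply: Rmult_le_pos; lra.
lra.
Qed.

Lemma rho_clos_le0 d (O : vec d -> Prop) rho : bl_scalar (clos O) rho -> (forall x, O x <-> rho x < 0) -> forall y, clos O y -> rho y <= 0.
Proof.
move=> [C [C0 [_ lip]]] hO y cy; apply: Rnot_lt_le => pos.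
have r0 : 0 < rho y / (C + 1) by apply: Rdiv_lt_0_compat; lra.
have [x [Ox xy]] := cy _ r0.
have clx : clos O x by move=> r rp; exists x; rewrite vdistxx.
have e : rho y / (C + 1) * (C + 1) = rho y by field; lra.
have := lip y x cy clx; have := Rle_abs (rho y - rho x); rewrite vdistC.
have := (hO x).1 Ox; have := vdist_ge0 x y; nra.
Qed.

Lemma grad_bdry_lower d (O : vec d -> Prop) (N : vec d -> vec d) L : is_bounded O -> is_open O ->
  (forall x y, vdist (N x) (N y) <= L * vdist x y) ->
  (forall x, bdry O x -> vnorm (N x) <> 0) ->
  exists c, 0 < c /\ forall x, bdry O x -> c <= vnorm (N x).
Proof.
move=> bO opn lip nz; apply: NNPP => no.
have cb : compact_in (bdry O) (@vdist d).
  apply: compact_sub (compact_clos bO) _ _; first by move=> x [].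
  by move=> h ch; apply: open_bdry_closed.
have [] := cb (fun w x => vnorm (N x) < w).
- by move=> w w' x hw; lra.
- move=> w w0; apply: NNPP => no1; apply: no; exists w; split=> // x bx.
  by apply: Rnot_lt_le => lt; apply: no1; exists x.
move=> h [bh near_h]; apply: (nz h bh).
apply: Rle_antisym; last exact: vnorm_ge0.
apply: le_epsilon => e e0; rewrite Rplus_0_l.
have L0 := Rabs_pos L.
have w0 : 0 < e / (Rabs L + 1) by apply: Rdiv_lt_0_compat; lra.
have [x [bx [Nx xh]]] := near_h _ w0.
have eq : e / (Rabs L + 1) * (Rabs L + 1) = e by field; lra.
have := vnorm_dist (N h) (N x); have := lip h x; rewrite (vdistC h).
have := Rle_abs L; have := vdist_ge0 x h; nra.
Qed.

(* With [P xi = xi - (M . xi) g] this is [P^T P + M M^T]; where [M . g = 1] it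
   maps [g] to [M]. *)
Definition frame_op (d : nat) (g M : vec d -> vec d) (z xi : vec d) : vec d :=
  vadd (vadd (vadd (vadd xi (vscal (-1 * dot (g z) xi) (M z)))
    (vscal (-1 * dot (M z) xi) (g z)))
    (vscal (1 * dot (M z) xi) (vscal (dot (g z) (g z)) (M z))))
    (vscal (1 * dot (M z) xi) (M z)).

Lemma frame_opE d (g M : vec d -> vec d) z xi eta :
  dot (frame_op g M z xi) eta = dot xi eta - dot (g z) xi * dot (M z) eta
    - dot (M z) xi * dot (g z) eta
    + dot (M z) xi * dot (M z) eta * (dot (g z) (g z) + 1).
Proof. by rewrite /frame_op !dotDl !dotZl; ring. Qed.

Lemma frame_op_bl d (K : vec d -> Prop) g M :
  bl_vec K g -> bl_vec K M -> bl_op K (frame_op g M).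
Proof.
move=> bg bM; rewrite /frame_op; do !apply: bl_op_add; try exact: bl_op_rank1.
  exact: bl_op_id.
by apply: (@bl_op_rank1 _ _ M (fun z => vscal (dot (g z) (g z)) (M z))) => //; apply: bl_scal => //; apply: bl_dot.
Qed.

Lemma frame_op_sym d (g M : vec d -> vec d) z C :
  (forall xi, vnorm (frame_op g M z xi) <= C * vnorm xi) -> sym_op (frame_op g M z) C.
Proof.
move=> bd; split; last split; last split=> //.
- move=> x y; apply: functional_extensionality => i.
  by rewrite /frame_op !dotDr /vadd /vscal; ring.
- move=> a x; apply: functional_extensionality => i.
  by rewrite /frame_op !dotZr /vadd /vscal; ring.
- by move=> x y; rewrite !frame_opE (dotC y x); ring.
Qed.

(** With [a = M . xi] the form equals [|xi - a g|^2 + a^2]. It controls both pieces of the splitting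
    [xi = (xi - a g) + a g], whatever [M] is. *)
Lemma frame_op_coer d (g M : vec d -> vec d) z xi G : dot (g z) (g z) <= G ->
  dot xi xi <= (2 + 2 * G) * dot (frame_op g M z xi) xi.
Proof.
move=> hG; have := dot_ge0 (g z).
have h1 := dot_ge0 (vsub xi (vscal (dot (M z) xi) (g z))).
(* Expanded, this is [|xi|^2 <= 2 |xi - a g|^2 + 2 |a g|^2]. *)
have h2 := dot_ge0 (vsub xi (vscal (2 * dot (M z) xi) (g z))).
rewrite !frame_opE; rewrite !dotE (dotC xi (g z)) in h1 h2.
set q := dot (g z) (g z) in hG h1 h2 *; set a := dot (M z) xi in h1 h2 *.
set b := dot (g z) xi in h1 h2 *; set X := dot xi xi in h1 h2 * => q0.
have k1 : X - 2 * a * b + a * a * q >= 0 by lra.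
have k2 : X - 4 * a * b + 4 * (a * a * q) >= 0 by lra.
have a2 : 0 <= a * a by nra.
have k3 : 0 <= X - b * a - a * b + a * a * (q + 1) by nra.
have k4 : X <= (2 + 2 * q) * (X - b * a - a * b + a * a * (q + 1)) by nra.
nra.
Qed.

(** For boundary [x], symmetry and [A x (gamma x) = M x] turn [A x (x - y) . gamma x] into
    [M x . (x - y)], which is nonnegative up to a square because [M x] is an outward normal and [y]
    lies in the closure. Passing from [A x] to [A z] costs the Lipschitz term [|x - z| |x - y|]. *)
Lemma frame_exists d (O : vec d -> Prop) n gamma c0 :
  W2inf_domain O n -> (exists L, forall x y, vdist (gamma x) (gamma y) <= L * vdist x y) ->
  0 < c0 -> (forall x, bdry O x -> dot (gamma x) (n x) >= c0) ->
  exists rho N A C c, oblique_frame O gamma rho N A C c.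
Proof.
move=> [bO [opn [rho [N [grad [[L lipN] [hO hn]]]]]]] [L' lipg] c00 hgn.
have rhoC := C11_of_grad grad lipN.
have bN := lip_bl bO lipN; have bg := lip_bl bO lipg; have br := C11_bl bO rhoC lipN.
have [c1 [c10 hc1]] := grad_bdry_lower bO opn lipN (fun x bx => (hn x bx).1).
(* On the boundary [N = |N| n], with [|N| >= c1] and [n . gamma >= c0]. *)
pose c := c0 * c1; have cp : 0 < c by apply: Rmult_lt_0_compat.
have hNg x : bdry O x -> c <= dot (N x) (gamma x).
  move=> bx; have [nz nE] := hn x bx.
  have -> : N x = vscal (vnorm (N x)) (n x).
    by apply: functional_extensionality => i; rewrite /vscal nE; field.
  rewrite dotZl dotC; have := hgn x bx; have := hc1 x bx; rewrite /c; nra.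
(* On the boundary the floor [c] is inactive, so [M . gamma = 1] there; elsewhere it keeps [M]
   bounded and Lipschitz. *)
pose M x := vscal (/ Rmax (dot (N x) (gamma x)) c) (N x).
have bM : bl_vec (clos O) M by apply: bl_scal => //; apply: bl_inv => //; apply: bl_dot.
have bA := frame_op_bl bg bM.
have [CA [CA0 [bdA lipA]]] := bA.
have [Cg [Cg0 [bdg _]]] := bg; have [CN [CN0 [bdN _]]] := bN.
have [Cr [Cr0 [bdr lipr]]] := br.
have [B [B0 hB]] := clos_bounded bO.
have [Cq [Cq0 hq]] := rhoC.
have rho_le0 := rho_clos_le0 br hO.
(* Since [rho y <= 0 <= rho x], the Taylor expansion of [rho] at [x] bounds [N x . (x - y)] below by
   its quadratic remainder. *)
have Mbd x y : bdry O x -> clos O y -> - (Cq * / c) * (vdist x y * vdist x y) <= dot (M x) (vsub x y).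
  move=> bx cy; have [clx nOx] := bx; rewrite /M dotZl Rmax_left; last exact: hNg.
  have := rho_le0 y cy; have rx : 0 <= rho x.
    by apply: Rnot_lt_le => lt; apply: nOx; apply/hO.
  have [h _] := hq x y; have := Rle_abs (- (rho y - rho x - dot (N x) (vsub y x))).
  rewrite Rabs_Ropp.
  rewrite vdistC in h.
  have -> : dot (N x) (vsub x y) = - dot (N x) (vsub y x) by rewrite !dotBr; ring.
  move=> h1 h2; have h3 : - Cq * (vdist x y * vdist x y) <= - dot (N x) (vsub y x) by lra.
  have gc := hNg x bx.
  have i1 : / dot (N x) (gamma x) <= / c by apply: Rinv_le_contravar.
  have i0 : 0 < / dot (N x) (gamma x) by apply: Rinv_0_lt_compat; lra.
  have Q0 : 0 <= Cq * (vdist x y * vdist x y) by apply: Rmult_le_pos => //; have := vdist_ge0 x y; nra.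
  set D := vdist x y * vdist x y in h3 Q0 *.
  set i := / dot _ _ in i0 i1 *; set E := - dot _ _ in h3 *.
  have k1 : i * (- Cq * D) <= i * E by apply: Rmult_le_compat_l; lra.
  have k2 : i * (Cq * D) <= / c * (Cq * D) by apply: Rmult_le_compat_r.
  lra.
have AE x xi : bdry O x -> dot (frame_op gamma M x xi) (gamma x) = dot (M x) xi.
  move=> bx; rewrite frame_opE.
  have -> : dot (M x) (gamma x) = 1.
    rewrite /M dotZl Rmax_left; last exact: hNg.
    by field; have := hNg x bx; lra.
  by rewrite (dotC xi); ring.
have bdx x : bdry O x -> clos O x by case.
have ci := Rinv_0_lt_compat c cp.
have e1 : 0 <= Cq * / c by nra.
have e2 : 0 <= CA * Cg by nra.
have e3 : 0 <= Cg * Cg by nra.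
(* One constant for all fields: [2 + 2 * (Cg * Cg)] is for coercivity, [Cq * / c + CA * Cg] for the
   boundary inequality, [B + B] for the diameter. *)
pose C := 1 + CA + (2 + 2 * (Cg * Cg)) + (Cq * / c + CA * Cg) + Cr + CN + Cg + (B + B).
exists rho, N, (frame_op gamma M), C, c; split=> //.
- by rewrite /C; lra.
- move=> z cz; apply: frame_op_sym => xi; apply: Rle_trans (bdA _ _ cz) _.
  by apply: Rmult_le_compat_r; [exact: vnorm_ge0 | rewrite /C; lra].
- move=> z xi cz; apply: Rle_trans (frame_op_coer M xi (_ : dot (gamma z) (gamma z) <= Cg * Cg)) _.
    by rewrite -vnorm2; have := bdg z cz; have := vnorm_ge0 (gamma z); nra.
  have := frame_op_coer M xi (Rle_refl (dot (gamma z) (gamma z))).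
  have := dot_ge0 xi; have := dot_ge0 (gamma z) => g0 x0 hc.
  have A0 : 0 <= dot (frame_op gamma M z xi) xi by nra.
  by apply: Rmult_le_compat_r => //; rewrite /C; lra.
- move=> z z' xi cz cz'; apply: Rle_trans (lipA _ _ _ cz cz') _.
  have := vnorm_ge0 xi; have := vdist_ge0 z z' => z0 x0.
  by rewrite !Rmult_assoc; apply: Rmult_le_compat_r; [nra | rewrite /C; lra].
- move=> x y z bx cy cz; set xi := vsub x y.
  have -> : dot (frame_op gamma M z xi) (gamma x) = dot (frame_op gamma M x xi) (gamma x)
    - dot (vsub (frame_op gamma M x xi) (frame_op gamma M z xi)) (gamma x).
    by rewrite !dotBl; ring.
  rewrite AE //; have := Mbd x y bx cy; rewrite -/xi.
  have h := dot_vnorm (vsub (frame_op gamma M x xi) (frame_op gamma M z xi)) (gamma x).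
  have l := lipA x z xi (bdx x bx) cz; have g := bdg x (bdx x bx).
  rewrite -/(vdist (frame_op _ _ _ _) _) in h.
  have k : vdist (frame_op gamma M x xi) (frame_op gamma M z xi) * vnorm (gamma x)
    <= CA * vdist x z * vnorm xi * Cg.
    by apply: Rmult_le_compat => //; [exact: vdist_ge0 | exact: vnorm_ge0].
  have -> : vdist x y = vnorm xi by [].
  have n0 := vnorm_ge0 xi; have z0 := vdist_ge0 x z.
  set D := vnorm xi in k n0 *; set Z := vdist x z in k z0 *.
  have p1 : 0 <= D * D by nra.
  have p2 : 0 <= Z * D by nra.
  have p3 : 0 <= (C - Cq * / c) * (D * D) by apply: Rmult_le_pos => //; rewrite /C; lra.
  have p4 : 0 <= (C - CA * Cg) * (Z * D) by apply: Rmult_le_pos => //; rewrite /C; lra.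
  lra.
- by move=> x cx; have := bdr x cx; rewrite /C; lra.
- move=> x y cx cy; apply: Rle_trans (lipr x y cx cy) _.
  by apply: Rmult_le_compat_r; [exact: vdist_ge0 | rewrite /C; lra].
- by move=> x cx; have := bdN x cx; rewrite /C; lra.
- by move=> x cx; have := bdg x cx; rewrite /C; lra.
- move=> x y cx cy; have := vnormB x y; have := hB x cx; have := hB y cy.
  by rewrite -/(vdist x y) /C; lra.
Qed.


(** * Coefficients and the Hamiltonian *)

Definition Q_set (d : nat) (T : R) (O : vec d -> Prop) : R * vec d -> Prop :=
  prod_set (fun t => 0 <= t <= T) (clos O).
Definition Q_dist (d : nat) : R * vec d -> R * vec d -> R :=
  prod_dist (fun s t => Rabs (s - t)) (@vdist d).

Lemma compact_Q d T (O : vec d -> Prop) : is_bounded O -> compact_in (Q_set T O) (@Q_dist d).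
Proof. by move=> bO; apply: compact_prod; [exact: compact_itv | exact: compact_clos]. Qed.

Lemma Q_dist_lt d (p q : R * vec d) w : Q_dist p q < w ->
  Rabs (p.1 - q.1) < w /\ vdist p.2 q.2 < w.
Proof.
have l1 := Rmax_l (Rabs (p.1 - q.1)) (vdist p.2 q.2).
have l2 := Rmax_r (Rabs (p.1 - q.1)) (vdist p.2 q.2).
by rewrite /Q_dist /prod_dist => h; lra.
Qed.

Lemma prod_dist_tri X Y (D : X -> X -> R) (D' : Y -> Y -> R) p q r :
  (forall p q h, D p h <= D p q + D q h) -> (forall p q h, D' p h <= D' p q + D' q h) ->
  prod_dist D D' p r <= prod_dist D D' p q + prod_dist D D' q r.
Proof.
move=> tD tD'; rewrite /prod_dist; apply: Rmax_lub.
  apply: Rle_trans (tD _ q.1 _) _.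
  by apply: Rplus_le_compat; exact: Rmax_l.
apply: Rle_trans (tD' _ q.2 _) _.
by apply: Rplus_le_compat; exact: Rmax_r.
Qed.

(** The matrix enters only through its action on vectors. In time there is no rate, only the uniform
    modulus [cr_unif], to be evaluated at a tolerance depending on the space penalty. *)
Record coef_reg (d m : nat) (T : R) (O : vec d -> Prop) (b : R -> vec d -> vec d)
  (sigma : R -> vec d -> mat d m) (B : R) : Prop := {
  cr_B : 0 <= B;
  cr_b : forall t x, inQ T O t x -> vnorm (b t x) <= B;
  cr_s : forall t x p, inQ T O t x -> vnorm (trmul (sigma t x) p) <= B * vnorm p;
  cr_blip : forall t x y, 0 <= t <= T -> clos O x -> clos O y ->
    vdist (b t x) (b t y) <= B * vdist x y;
  cr_slip : forall t x y p, 0 <= t <= T -> clos O x -> clos O y ->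
    vdist (trmul (sigma t x) p) (trmul (sigma t y) p) <= B * vdist x y * vnorm p;
  cr_unif : forall e, 0 < e -> exists w, 0 < w /\ forall t s x, inQ T O t x -> inQ T O s x ->
    Rabs (t - s) < w -> vdist (b t x) (b s x) <= e /\
    forall p, vdist (trmul (sigma t x) p) (trmul (sigma s x) p) <= e * vnorm p
}.

Lemma coef_reg_exists d m T (O : vec d -> Prop) b (sigma : R -> vec d -> mat d m) :
  is_bounded O -> vcont_on_Q T O b -> mcont_on_Q T O sigma ->
  (exists L, forall t x y, 0 <= t <= T -> clos O x -> clos O y ->
     vdist (b t x) (b t y) <= L * vdist x y /\
     mdist (sigma t x) (sigma t y) <= L * vdist x y) ->
  exists B, coef_reg T O b sigma B.
Proof.
move=> bO cb cs [L lip]; have cQ := @compact_Q d T O bO.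
have [B1 [B10 hB1]] : exists B, 0 <= B /\ forall p, Q_set T O p -> vnorm (b p.1 p.2) <= B.
  apply: (compact_bound cQ) => [B B' x|[t x] Kh]; first lra.
  have [w [w0 hw]] := cb t x Kh 1 Rlt_0_1.
  exists (vnorm (b t x) + 1), w; split=> // -[s y] Ky /Q_dist_lt [/= h1 h2].
  by have := hw s y Ky h1 h2; have := vnorm_dist (b s y) (b t x); lra.
have [B2 [B20 hB2]] : exists B, 0 <= B /\ forall q, Q_set T O q ->
    forall p, vnorm (trmul (sigma q.1 q.2) p) <= B * vnorm p.
  apply: (compact_bound cQ) => [B B' x hB h p|[t x] Kh].
    by have := h p; have := vnorm_ge0 p; nra.
  have [w [w0 hw]] := cs t x Kh 1 Rlt_0_1.
  exists (mnorm (sigma t x) + 1), w; split=> // -[s y] Ky /Q_dist_lt [/= h1 h2] p.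
  have := hw s y Ky h1 h2; have := trmul_dist (sigma s y) (sigma t x) p.
  have := trmul_norm (sigma t x) p; have := vnorm_ge0 p.
  have := vnorm_dist (trmul (sigma s y) p) (trmul (sigma t x) p); nra.
have L0 := Rabs_pos L; have LL := Rle_abs L.
exists (B1 + B2 + Rabs L); split.
- lra.
- by move=> t x Qx; have := hB1 (t, x) Qx => /=; lra.
- by move=> t x p Qx; have := hB2 (t, x) Qx p => /=; have := vnorm_ge0 p; nra.
- by move=> t x y ht cx cy; have [h _] := lip t x y ht cx cy; have := vdist_ge0 x y; nra.
- move=> t x y p ht cx cy; have [_ h] := lip t x y ht cx cy.
  apply: Rle_trans (trmul_dist _ _ _) _; apply: Rmult_le_compat_r; first exact: vnorm_ge0.
  by have := vdist_ge0 x y; nra.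
move=> e e0.
have [] := @compact_unif _ _ _ (fun e p q => vdist (b p.1 p.2) (b q.1 q.2) <= e /\
    forall v, vdist (trmul (sigma p.1 p.2) v) (trmul (sigma q.1 q.2) v) <= e * vnorm v) cQ _ _ _ _ e e0.
- move=> p q h; apply: prod_dist_tri => [x y z|x y z]; last exact: vdist_tri.
  have -> : x - z = (x - y) + (y - z) by ring.
  exact: Rabs_triang.
- by move=> p q; rewrite /Q_dist /prod_dist Rabs_minus_sym vdistC.
- move=> e' p q h [p1 p2] [q1 q2]; split=> [|v].
    by have := vdist_tri (b h.1 h.2) (b p.1 p.2) (b q.1 q.2); rewrite (vdistC (b h.1 h.2)); lra.
  have := vdist_tri (trmul (sigma h.1 h.2) v) (trmul (sigma p.1 p.2) v) (trmul (sigma q.1 q.2) v).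
  by rewrite (vdistC (trmul (sigma h.1 h.2) v)); have := p2 v; have := q2 v; lra.
- move=> [t x] Kh e' e'0; have [w [w0 hw]] := cb t x Kh e' e'0.
  have [w' [w'0 hw']] := cs t x Kh e' e'0.
  exists (Rmin w w'); split; first exact: Rmin_glb_lt.
  move=> [s y] Ky /Q_dist_lt [/= h1 h2].
  have l1 := Rmin_l w w'; have l2 := Rmin_r w w'; split.
    by apply: Rlt_le; apply: hw => //; lra.
  move=> v; apply: Rle_trans (trmul_dist _ _ _) _; apply: Rmult_le_compat_r; first exact: vnorm_ge0.
  by apply: Rlt_le; apply: hw' => //; lra.
move=> w [w0 hw]; exists w; split=> // t s x Qt Qs ts.
apply: (hw (t, x) (s, x)) => //.
by rewrite /Q_dist /prod_dist /= vdistxx; apply: Rmax_lub_lt.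
Qed.

Lemma Ham_lower d m (b : R -> vec d -> vec d) (sigma : R -> vec d -> mat d m) t x p B :
  vnorm (b t x) <= B -> - B * vnorm p <= Ham b sigma t x p.
Proof.
move=> hb; have := dot_vnorm (b t x) p; rewrite /Ham.
have := pow2_ge_0 (vnorm (trmul (sigma t x) p)); have := vnorm_ge0 p; nra.
Qed.

(* Since [lam < 1], convexity of [H] absorbs the difference of the quadratic
   parts: [|a'|^2 <= |a|^2 / lam + |a - a'|^2 / (1 - lam)]. *)
Lemma Ham_gap d m (b : R -> vec d -> vec d) (sigma : R -> vec d -> mat d m) t s x y p q lam B r E :
  0 < lam < 1 -> 0 <= B -> vnorm (b t x) <= B ->
  (forall v, vnorm (trmul (sigma t x) v) <= B * vnorm v) ->
  vdist (b t x) (b s y) * vnorm q <= r ->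
  vdist (trmul (sigma t x) q) (trmul (sigma s y) q) <= r ->
  vdist p q <= E ->
  - ((B * E + r) * (B * E + r) / (2 * (1 - lam)) + B * E + r)
    <= lam * Ham b sigma t x (vscal (/ lam) p) - Ham b sigma s y q.
Proof.
move=> [l0 l1] B0 hb hs hbr hsr hE; rewrite /Ham trmulZ dotZr vnorm_scal.
rewrite Rabs_pos_eq; last by apply: Rlt_le; apply: Rinv_0_lt_compat.
set a := trmul (sigma t x) p; set a' := trmul (sigma s y) q in hsr *.
have D0 := vdist_ge0 a a'.
have haa : vdist a a' <= B * E + r.
  have := vdist_tri (trmul (sigma t x) q) a a'.
  have : vdist a (trmul (sigma t x) q) <= B * E.
    have -> : vdist a (trmul (sigma t x) q) = vnorm (trmul (sigma t x) (vsub p q)).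
      by rewrite !vsubE trmulD trmulZ -vsubE.
    by apply: Rle_trans (hs _) _; apply: Rmult_le_compat_l.
  lra.
have hn : vnorm a' <= vnorm a + vdist a a' by rewrite vdistC; exact: vnorm_dist.
have hdots : dot (b t x) p - dot (b s y) q <= B * E + r.
  have -> : dot (b t x) p - dot (b s y) q
    = dot (b t x) (vsub p q) + dot (vsub (b t x) (b s y)) q by rewrite !dotE; ring.
  have h1 := dot_vnorm (b t x) (vsub p q); have h2 := dot_vnorm (vsub (b t x) (b s y)) q.
  have : vnorm (b t x) * vnorm (vsub p q) <= B * E.
    by apply: Rmult_le_compat => //; exact: vnorm_ge0.
  rewrite -/(vdist (b t x) (b s y)) in h2; lra.
have n0 := vnorm_ge0 a; have n'0 := vnorm_ge0 a'.
set X := vnorm a in hn n0 *; set X' := vnorm a' in hn n'0 *.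
set D := vdist a a' in D0 haa hn *; set V := B * E + r in haa hdots *.
have k1 : X' ^ 2 <= X * X / lam + D * D / (1 - lam).
  have k : X' ^ 2 <= (X + D) * (X + D) by nra.
  apply: Rle_trans k _.
  have -> : X * X / lam + D * D / (1 - lam) = (X + D) * (X + D)
    + (((1 - lam) * X - lam * D) * ((1 - lam) * X - lam * D)) / (lam * (1 - lam)).
    by field; lra.
  suff: 0 <= ((1 - lam) * X - lam * D) * ((1 - lam) * X - lam * D) / (lam * (1 - lam)) by lra.
  apply: Rmult_le_pos; first by rewrite -/(Rsqr _); exact: Rle_0_sqr.
  by apply: Rlt_le; apply: Rinv_0_lt_compat; apply: Rmult_lt_0_compat; lra.
have k2 : D * D / (1 - lam) <= V * V / (1 - lam).
  apply: Rmult_le_compat_r; last nra.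
  by apply: Rlt_le; apply: Rinv_0_lt_compat; lra.
(* Dividing the momentum by [lam] and multiplying [H] by [lam] leaves the drift term unchanged but
   enlarges the quadratic one by [1 / lam]: this is the room that [k1] uses. *)
have e1 : lam * (/ 2 * (/ lam * X) ^ 2 - / lam * dot (b t x) p)
  = / 2 * (X * X / lam) - dot (b t x) p by field; lra.
have e2 : V * V / (2 * (1 - lam)) = / 2 * (V * V / (1 - lam)) by field; lra.
have eV : V = B * E + r by []; rewrite e1 e2; lra.
Qed.


(** * The terminal condition *)

Lemma clos_interior_or_bdry d (O : vec d -> Prop) x : clos O x -> O x \/ bdry O x.
Proof. by move=> cx; case: (classic (O x)); [left | right]. Qed.

Lemma frame_quad_lip d (O : vec d -> Prop) gamma rho N A C c x y z x' y' z' :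
  oblique_frame O gamma rho N A C c ->
  clos O x -> clos O y -> clos O z -> clos O x' -> clos O y' -> clos O z' ->
  dot (A z (vsub x y)) (vsub x y) - dot (A z' (vsub x' y')) (vsub x' y')
    <= C * C * C * vdist z z' + 2 * (C * C) * (vdist x x' + vdist y y').
Proof.
move=> fr cx cy cz cx' cy' cz'; have C1 := fr_C fr.
have [AD [AZ [As Ab]]] := fr_sym fr cz'.
(* By symmetry of [A z'], a difference of two values of its quadratic form factors like a difference
   of squares. *)
have split_eq xi xi' : dot (A z xi) xi - dot (A z' xi') xi'
  = dot (vsub (A z xi) (A z' xi)) xi + dot (A z' (vsub xi xi')) (vadd xi xi').
  rewrite (sym_opB xi xi' (fr_sym fr cz')) !dotBl !dotDr.
  by have := As xi xi'; lra.
rewrite split_eq; set xi := vsub x y; set xi' := vsub x' y'.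
have n1 : vnorm xi <= C by exact: (fr_diam fr).
have n2 : vnorm xi' <= C by exact: (fr_diam fr).
have hd : vnorm (vsub xi xi') <= vdist x x' + vdist y y'.
  have -> : vsub xi xi' = vsub (vsub x x') (vsub y y').
    by apply: functional_extensionality => i; rewrite /xi /xi' /vsub; ring.
  exact: vnormB.
have p0 := vnorm_ge0 xi; have z0 := vdist_ge0 z z'.
have h1 : dot (vsub (A z xi) (A z' xi)) xi <= C * C * C * vdist z z'.
  apply: Rle_trans (dot_vnorm _ _) _.
  have l : vnorm (vsub (A z xi) (A z' xi)) <= C * vdist z z' * C.
    apply: Rle_trans (fr_lip fr xi cz cz') _.
    by apply: Rmult_le_compat_l => //; nra.
  have : vnorm (vsub (A z xi) (A z' xi)) * vnorm xi <= C * vdist z z' * C * C.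
    by apply: Rmult_le_compat => //; exact: vnorm_ge0.
  lra.
have h2 : dot (A z' (vsub xi xi')) (vadd xi xi') <= 2 * (C * C) * (vdist x x' + vdist y y').
  apply: Rle_trans (dot_vnorm _ _) _.
  have s := vnormD xi xi'.
  have l : vnorm (A z' (vsub xi xi')) <= C * (vdist x x' + vdist y y').
    by apply: Rle_trans (Ab _) _; apply: Rmult_le_compat_l => //; lra.
  have : vnorm (A z' (vsub xi xi')) * vnorm (vadd xi xi')
    <= C * (vdist x x' + vdist y y') * (2 * C).
    by apply: Rmult_le_compat => //; [exact: vnorm_ge0|exact: vnorm_ge0|lra].
  lra.
lra.
Qed.

Lemma usc_Q d T (O : vec d -> Prop) u h : usc_on_Q T O u -> Q_set T O h ->
  usc_at (Q_set T O) (@Q_dist d) (fun p => u p.1 p.2) h.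
Proof.
move=> uu; case: h => t x Qh e e0; have [w [w0 hw]] := uu t x Qh e e0.
by exists w; split=> // -[s y] Qp /Q_dist_lt [/= h1 h2]; apply: hw.
Qed.

Lemma Q_dist_ge0 d (p q : R * vec d) : 0 <= Q_dist p q.
Proof. by apply: Rle_trans (Rmax_l _ _); exact: Rabs_pos. Qed.

(* The penalty [K (T - t)], with [K] large depending on the weight [a] of the quadratic term, makes the
   differential part of the operator positive at a maximum. *)
Lemma terminal_le d m T (O : vec d -> Prop) gamma rho N A C c b
  (sigma : R -> vec d -> mat d m) psi u B :
  is_bounded O -> 0 < T ->
  oblique_frame O gamma rho N A C c -> coef_reg T O b sigma B ->
  cont_on_Q T O psi -> bounded_on_Q T O u -> usc_on_Q T O u ->
  visc_sub T O gamma b sigma psi u ->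
  forall x, clos O x -> u T x <= psi T x.
Proof.
move=> bO T0 fr cr cpsi [Mu hMu] uu sub x0 cx0.
have QT : inQ T O T x0 by split=> //; lra.
have C1 := fr_C fr; have c0 := fr_c fr; have B0 := cr_B cr.
apply: le_epsilon => e e0.
(* The first bound makes the total error [2 * om] at most [e]; the second keeps the oblique
   derivative of the test function positive, the quadratic term contributing at least
   [- 8 * (C * C) * om] against [c]. *)
pose om := Rmin (e / 2) (c / (16 * (C * C))).
have CC : 1 <= C * C by nra.
have om0 : 0 < om.
  by apply: Rmin_glb_lt; [lra | apply: Rdiv_lt_0_compat; lra].
have om1 : om <= e / 2 by exact: Rmin_l.
have om2 : om * (16 * (C * C)) <= c.
  have l := Rmin_r (e / 2) (c / (16 * (C * C))).
  have eq : c / (16 * (C * C)) * (16 * (C * C)) = c by field; lra.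
  by rewrite -[X in _ <= X]eq; apply: Rmult_le_compat_r; [lra | exact: l].
have [r1 [r10 hr1]] := uu T x0 QT om om0.
have [r2 [r20 hr2]] := cpsi T x0 QT om om0.
pose r := Rmin (Rmin r1 r2) (om / C).
have r0 : 0 < r.
  by apply: Rmin_glb_lt; [exact: Rmin_glb_lt | apply: Rdiv_lt_0_compat; lra].
have rr1 : r <= r1 by apply: Rle_trans (Rmin_l _ _) (Rmin_l _ _).
have rr2 : r <= r2 by apply: Rle_trans (Rmin_l _ _) (Rmin_r _ _).
have rom : C * r <= om.
  have l := Rmin_r (Rmin r1 r2) (om / C).
  have eq : C * (om / C) = om by field; lra.
  by rewrite -eq; apply: Rmult_le_compat_l; [lra | exact: l].
have Mu0 : 0 <= Mu by apply: Rle_trans (hMu T x0 QT); exact: Rabs_pos.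
(* Crude bound on the penalties at the maximum, obtained by comparison with [(T, x0)]. The weights
   [a] and [K] are calibrated on it to force the maximum within [r] of that point. *)
pose R0 := 2 * Mu + 2 * C + 1.
pose a := C * R0 / (r * r) + 1.
have R01 : 1 <= R0 by rewrite /R0; lra.
have rr0 : 0 < r * r by nra.
have CR : 0 < C * R0 by nra.
have aP : 1 <= a.
  by rewrite /a; have : 0 < C * R0 / (r * r) by [apply: Rdiv_lt_0_compat]; lra.
have ar : C * R0 < a * (r * r).
  have -> : a * (r * r) = C * R0 + r * r by rewrite /a; field; lra.
  lra.
have P0 : 0 <= B * (2 * a * (C * C) + C) by apply: Rmult_le_pos => //; nra.
(* The first product bounds [B] times the gradient of the test function, hence the negative part of
   [H]; [+ 1] makes the operator strictly positive; [R0 / r] forces [T - t < r]. *)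
pose K := B * (2 * a * (C * C) + C) + 1 + R0 / r.
have Rr : 0 < R0 / r by apply: Rdiv_lt_0_compat; lra.
have Kr : R0 < K * r.
  have -> : K * r = (B * (2 * a * (C * C) + C) + 1) * r + R0 by rewrite /K; field; lra.
  have : 0 < (B * (2 * a * (C * C) + C) + 1) * r by apply: Rmult_lt_0_compat; lra.
  lra.
pose q x := dot (A x0 (vsub x x0)) (vsub x x0).
have q0 x : vdist x x0 * vdist x x0 <= C * q x by rewrite vdist2; exact: (fr_coer fr).
pose f x := a * q x + rho x.
pose J (p : R * vec d) := u p.1 p.2 + (K * p.1 + (- a * q p.2 + - rho p.2)).
have [] := @usc_max _ (Q_set T O) (@Q_dist d) J (compact_Q bO).
- move=> h Qh; apply: usc_add; first exact: usc_Q.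
  have l1 p := Rmax_l (Rabs (p.1 - h.1)) (vdist p.2 h.2).
  have l2 p := Rmax_r (Rabs (p.1 - h.1)) (vdist p.2 h.2).
  apply: (usc_lip (C := K + a * (2 * (C * C)) + C)); last by move=> p; exact: Q_dist_ge0.
  move=> p Qp; rewrite /= /Q_dist /prod_dist.
  have k1 := frame_quad_lip fr Qh.2 cx0 cx0 Qp.2 cx0 cx0.
  have k2 := fr_rho_lip fr Qh.2 Qp.2; rewrite (vdistC h.2) vdistxx in k1; rewrite (vdistC h.2) in k2.
  rewrite -!/(q _) in k1.
  have k3 := Rle_abs (rho h.2 - rho p.2); have k4 := Rle_abs (p.1 - h.1).
  have {}l1 := l1 p; have {}l2 := l2 p.
  set W := Rmax _ _ in l1 l2 *.
  have K0 : 0 <= K by rewrite /K; lra.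
  have m1 : K * (p.1 - h.1) <= K * W by apply: Rmult_le_compat_l => //; lra.
  have m2 : C * vdist p.2 h.2 <= C * W by apply: Rmult_le_compat_l; lra.
  have m3 : a * (q h.2 - q p.2) <= a * (2 * (C * C) * W).
    apply: Rmult_le_compat_l; first lra.
    by have : 2 * (C * C) * vdist p.2 h.2 <= 2 * (C * C) * W; [apply: Rmult_le_compat_l; lra | lra].
  lra.
- by exists (T, x0).
move=> [t x] [Qtx hmax]; rewrite /J /= in hmax.
have [/= ht cx] := Qtx.
have qx0 : q x0 = 0 by exact: dot_vsub_diag.
have := hmax (T, x0) QT; rewrite /= qx0 => hm.
have hu := hMu t x Qtx; have hu0 := hMu T x0 QT.
have hr := fr_rho fr cx; have hr0 := fr_rho fr cx0.
have bu := Rle_abs (u t x); have bu0 := Rle_abs (- u T x0); rewrite Rabs_Ropp in bu0.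
have br := Rle_abs (- rho x); have br0 := Rle_abs (rho x0); rewrite Rabs_Ropp in br.
have qx := q0 x; have d0 := vdist_ge0 x x0.
have qp : 0 <= q x by have : 0 <= vdist x x0 * vdist x x0 by [nra]; nra.
have K0 : 0 < K by rewrite /K; lra.
have Kt : 0 <= K * (T - t) by apply: Rmult_le_pos; lra.
have aq : 0 <= a * q x by apply: Rmult_le_pos; lra.
have hR0 : a * q x + K * (T - t) <= R0 by rewrite /R0; lra.
have xr : vdist x x0 < r.
  have : a * (vdist x x0 * vdist x x0) < a * (r * r).
    apply: Rle_lt_trans ar; apply: Rle_trans (_ : a * (C * q x) <= _).
      by apply: Rmult_le_compat_l; lra.
    have : C * (a * q x) <= C * R0 by apply: Rmult_le_compat_l; lra.
    lra.
  move/(Rmult_lt_reg_l _ _ _ (Rlt_le_trans _ _ _ Rlt_0_1 aP)) => sq; apply: (Rsqr_incrst_0 _ _ sq) => //; lra.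
have tr : T - t < r.
  have : K * (T - t) < K * r by lra.
  exact: Rmult_lt_reg_l.
have tT : Rabs (t - T) < r by apply: Rabs_def1; lra.
have near_u := hr1 t x Qtx ltac:(lra) ltac:(lra).
have near_psi := hr2 t x Qtx ltac:(lra) ltac:(lra).
have rhox : rho x0 - rho x <= om.
  apply: Rle_trans (Rle_abs _) _; apply: Rle_trans (fr_rho_lip fr cx0 cx) _.
  rewrite vdistC; apply: Rle_trans rom; apply: Rmult_le_compat_l; lra.
(* Once the maximum is localized, semicontinuity of [u] at [(T, x0)] improves the bound [R0] to
   [2 * om], with [a] already fixed; the boundary term below relies on this. *)
have aq2 : a * q x <= 2 * om by lra.
(* By maximality [u T x0] exceeds [u t x] by at most [rho x0 - rho x <= om], and [psi] varies by
   less than [om]. *)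
suff hE : u t x <= psi t x.
  have := Rle_abs (psi t x - psi T x0); lra.
pose Df x := vadd (vscal a (vscal 2 (A x0 (vsub x x0)))) (N x).
have fC : C11 f Df.
  apply: C11_add (fr_C11 fr); apply: C11_scal.
  by apply: (C11_quad (C := C)); [lra | exact: (fr_sym fr)].
have [] := sub _ _ _ t x (C1_test 0 0 (- K) fC).
  split=> //; exists 1; split; first lra.
  by move=> t' x' Q' _ _; have := hmax (t', x') Q'; rewrite /= /f; lra.
set E0 := Eop _ _ _ _ _ _ _ _ => hO hB.
have [AD [AZ [As Ab]]] := fr_sym fr cx0.
have DfB : vnorm (Df x) <= 2 * a * (C * C) + C.
  apply: Rle_trans (vnormD _ _) _; rewrite !vnorm_scal !Rabs_pos_eq; try lra.
  have h1 := fr_N_bd fr cx; have h2 := Ab (vsub x x0); have h3 := fr_diam fr cx cx0.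
  have h4 : vnorm (A x0 (vsub x x0)) <= C * C.
    by apply: Rle_trans h2 _; apply: Rmult_le_compat_l => //; lra.
  have : a * (2 * vnorm (A x0 (vsub x x0))) <= a * (2 * (C * C)) by apply: Rmult_le_compat_l; lra.
  lra.
have EE : E0 <= 0 -> u t x <= psi t x.
  rewrite /E0 /Eop.
  have := Ham_lower sigma (Df x) (cr_b cr Qtx).
  have : B * vnorm (Df x) <= B * (2 * a * (C * C) + C) by apply: Rmult_le_compat_l.
  have eK : K = B * (2 * a * (C * C) + C) + 1 + R0 / r by [].
  set H := Ham _ _ _ _ _ => h1 h2.
  by rewrite /Rmin; case: Rle_dec; lra.
case: (clos_interior_or_bdry cx) => [Ox|bx]; first by apply: EE; apply: hO.
apply: EE; have := hB bx; set dg := dot _ _ => hmin.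
suff dg0 : 0 < dg by move: hmin; rewrite {1}/Rmin; case: Rle_dec; lra.
rewrite /dg /Df dotDl !dotZl.
have h1 := fr_bd fr bx cx0 cx0; have h2 := fr_N fr bx.
have h3 : a * (vdist x x0 * vdist x x0) <= C * (2 * om).
  apply: Rle_trans (_ : C * (a * q x) <= _); last by apply: Rmult_le_compat_l; lra.
  have : a * (vdist x x0 * vdist x x0) <= a * (C * q x) by apply: Rmult_le_compat_l; lra.
  lra.
have h4 : C * (a * (vdist x x0 * vdist x x0)) <= C * (C * (2 * om)) by apply: Rmult_le_compat_l; lra.
have h5 : a * (- C * (vdist x x0 * vdist x x0 + vdist x x0 * vdist x x0))
  <= a * dot (A x0 (vsub x x0)) (gamma x) by apply: Rmult_le_compat_l; lra.
have : 0 < om * (C * C) by apply: Rmult_lt_0_compat; lra.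
lra.
Qed.


(** * Doubling of variables *)

(** The gradient in [x] of the penalties, [delta rho] included; [grad_y] is minus their gradient in
    [y]. Only [x] is tied to [z], whence the extra term here. *)
Definition grad_x (d : nat) (N : vec d -> vec d) (A : vec d -> vec d -> vec d) (k delta : R)
  (x y z : vec d) : vec d :=
  vadd (vadd (vscal (k * k) (vscal 2 (A z (vsub x y)))) (vscal k (vscal 2 (vsub x z))))
    (vscal delta (N x)).

Definition grad_y (d : nat) (N : vec d -> vec d) (A : vec d -> vec d -> vec d) (k delta : R)
  (x y z : vec d) : vec d :=
  vadd (vscal (- (k * k)) (vscal 2 (A z (vsub y x)))) (vscal (- delta) (N y)).

Lemma vsub_opp d (x y : vec d) : vsub y x = vscal (-1) (vsub x y).
Proof. by apply: functional_extensionality => i; rewrite /vsub /vscal; ring. Qed.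

(** The hypothesis compares [z] with the competitor [x]. Lipschitz dependence of [A] puts one factor
    [|x - z|] on its right side against two on the left; cancelling one gives an estimate linear in
    [theta]. *)
Lemma frozen_point_close d (O : vec d -> Prop) gamma rho N A C c k x y z :
  oblique_frame O gamma rho N A C c -> clos O x -> clos O z -> 1 <= k ->
  k * (vdist x z * vdist x z)
    <= k * k * dot (A x (vsub x y)) (vsub x y) - k * k * dot (A z (vsub x y)) (vsub x y) ->
  k * vdist x z <= C * (k * k * (vdist x y * vdist x y)).
Proof.
move=> fr cx cz k1 hz; have C1 := fr_C fr.
have z0 := vdist_ge0 x z; have y0 := vdist_ge0 x y.
have h : dot (vsub (A x (vsub x y)) (A z (vsub x y))) (vsub x y)
  <= C * vdist x z * vdist x y * vdist x y.
  apply: Rle_trans (dot_vnorm _ _) _; apply: Rmult_le_compat_r; first exact: y0.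
  exact: (fr_lip fr).
rewrite dotBl in h.
have kk : 0 <= k * k by nra.
have h2 := Rmult_le_compat_l _ _ _ kk h.
case: (Rle_lt_or_eq_dec _ _ z0) => [zp|<-]; last first.
  rewrite Rmult_0_r; apply: Rmult_le_pos; first lra.
  by apply: Rmult_le_pos => //; nra.
apply: (Rmult_le_reg_r _ _ _ zp).
apply: Rle_trans (_ : k * (vdist x z * vdist x z) <= _); first by right; ring.
apply: Rle_trans hz _; apply: Rle_trans (_ : _ <= k * k * (C * vdist x z * vdist x y * vdist x y)) _.
  by apply: Rle_trans h2; right; ring.
by right; ring.
Qed.

Lemma penalty_gradients d (O : vec d -> Prop) gamma rho N A C c k delta x y z th :
  oblique_frame O gamma rho N A C c -> clos O x -> clos O y -> clos O z -> 1 <= k ->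
  0 <= delta -> k * vdist x z <= C * th ->
  k * k * (vdist x y * vdist x y) <= th -> th <= 1 ->
  let p := grad_x N A k delta x y z in
  let q := grad_y N A k delta x y z in
  (bdry O x -> delta * c - 6 * (C * C) * th <= dot p (gamma x)) /\
  (bdry O y -> dot q (gamma y) <= 6 * (C * C) * th - delta * c) /\
  vdist p q <= 2 * C * th + 2 * C * delta /\
  vnorm q <= 2 * (k * k) * C * vdist x y + C * delta.
Proof.
move=> fr cx cy cz k1 dl0 hz hth th1 p q; have C1 := fr_C fr.
have z0 := vdist_ge0 x z; have y0 := vdist_ge0 x y.
set Z := vdist x z in hz z0; set D := vdist x y in hth y0.
have kk : 0 <= k * k by nra.
have DD : 0 <= D * D by nra.
have th0 : 0 <= th by apply: Rle_trans hth; apply: Rmult_le_pos.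
have kD1 : k * D <= 1.
  apply: Rnot_lt_le => lt; have : 1 < (k * D) * (k * D) by nra.
  lra.
have kD0 : 0 <= k * D by nra.
have kZ0 : 0 <= k * Z by nra.
(* From [th <= 1] one has [k D <= 1], so the mixed term of [fr_bd] is no worse than [k Z]. *)
have ZD : k * k * (Z * D) <= C * th.
  apply: Rle_trans (_ : (k * Z) * (k * D) <= _); first by right; ring.
  apply: Rle_trans (_ : (k * Z) * 1 <= _); last lra.
  exact: Rmult_le_compat_l.
have CC : C <= C * C by nra.
have Cth : C * th <= C * C * th by apply: Rmult_le_compat_r.
have CCth : 0 <= C * C * th by apply: Rmult_le_pos => //; nra.
split; last split; last split.
- move=> bx; rewrite /p /grad_x !dotDl !dotZl.
  have h1 := fr_bd fr bx cy cz; rewrite -/D -/Z in h1.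
  have h2 := Rmult_le_compat_l _ _ _ kk h1.
  have h3 := Rmult_le_compat_l _ _ _ dl0 (fr_N fr bx).
  have h4 : - (C * C * th) <= k * dot (vsub x z) (gamma x).
    have h := dot_vnorm (vscal (-1) (vsub x z)) (gamma x); rewrite dotZl -vsub_opp in h.
    rewrite -/(vdist z x) vdistC -/Z in h.
    have h' : Z * vnorm (gamma x) <= Z * C.
      by apply: Rmult_le_compat_l => //; exact: (fr_gamma fr).
    have h'' := Rmult_le_compat_l k _ _ ltac:(lra) (Rle_trans _ _ _ h h').
    have : C * (k * Z) <= C * (C * th) by apply: Rmult_le_compat_l => //; lra.
    lra.
  have h5 : C * (k * k * (D * D) + k * k * (Z * D)) <= C * (th + C * th).
    by apply: Rmult_le_compat_l; lra.
  lra.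
- move=> byy; rewrite /q /grad_y !dotDl !dotZl.
  have h1 := fr_bd fr byy cx cz; rewrite (vdistC y x) -/D in h1.
  have h2 := Rmult_le_compat_l _ _ _ kk h1.
  have h3 := Rmult_le_compat_l _ _ _ dl0 (fr_N fr byy).
  have h6 : vdist y z <= D + Z by have := vdist_tri x y z; rewrite (vdistC y x).
  have h7 : k * k * (vdist y z * D) <= th + C * th.
    have : k * k * (vdist y z * D) <= k * k * ((D + Z) * D).
      by apply: Rmult_le_compat_l => //; apply: Rmult_le_compat_r.
    lra.
  have h5 : C * (k * k * (D * D) + k * k * (vdist y z * D)) <= C * (th + (th + C * th)).
    by apply: Rmult_le_compat_l; lra.
  lra.
(* Both gradients use the same frozen matrix [A z], so their terms of order [k^2] cancel exactly. *)
- have -> : vdist p q = vnorm (vadd (vscal (2 * k) (vsub x z)) (vscal delta (vadd (N x) (N y)))).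
    rewrite /vdist /p /q /grad_x /grad_y; congr vnorm.
    have [_ [AZ _]] := fr_sym fr cz.
    rewrite (vsub_opp x y) AZ.
    by apply: functional_extensionality => i; rewrite /vsub /vadd /vscal; ring.
  apply: Rle_trans (vnormD _ _) _; rewrite !vnorm_scal !Rabs_pos_eq; try lra.
  rewrite -/(vdist x z) -/Z.
  have := vnormD (N x) (N y); have := fr_N_bd fr cx; have := fr_N_bd fr cy => a1 a2 a3.
  have : delta * vnorm (vadd (N x) (N y)) <= delta * (2 * C) by apply: Rmult_le_compat_l => //; lra.
  lra.
rewrite /q /grad_y; apply: Rle_trans (vnormD _ _) _; rewrite !vnorm_scal !Rabs_Ropp !Rabs_pos_eq; try lra.
have [_ [_ [_ Ab]]] := fr_sym fr cz.
have := Ab (vsub y x); rewrite -/(vdist y x) (vdistC y x) -/D => h1.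
have h2 := Rmult_le_compat_l _ _ _ kk h1.
have := Rmult_le_compat_l _ _ _ dl0 (fr_N_bd fr cy).
lra.
Qed.

(** The functional involves [lam * u], so the test function for [u] itself carries a factor [/ lam].
    The positive oblique derivative rules out the boundary alternative, and the two conclusions are
    the two entries of the minimum; [t = T] is allowed. *)
Lemma sub_at_max d m T (O : vec d -> Prop) gamma rho N A C c b
  (sigma : R -> vec d -> mat d m) psi u lam beta delta k l t s x y z :
  oblique_frame O gamma rho N A C c -> visc_sub T O gamma b sigma psi u ->
  0 < lam -> clos O z -> inQ T O t x ->
  (forall t' x', inQ T O t' x' ->
    lam * u t' x' + beta * t' - delta * rho x' - l * ((t' - s) * (t' - s))
      - k * k * dot (A z (vsub x' y)) (vsub x' y) - k * dot (vsub x' z) (vsub x' z)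
    <= lam * u t x + beta * t - delta * rho x - l * ((t - s) * (t - s))
      - k * k * dot (A z (vsub x y)) (vsub x y) - k * dot (vsub x z) (vsub x z)) ->
  (bdry O x -> 0 < dot (grad_x N A k delta x y z) (gamma x)) ->
  u t x <= psi t x \/
  beta - 2 * l * (t - s)
    + lam * Ham b sigma t x (vscal (/ lam) (grad_x N A k delta x y z)) <= 0.
Proof.
move=> fr sub l0 cz Qtx hmax hbd; have C1 := fr_C fr.
have il := Rinv_0_lt_compat _ l0.
pose f x := / lam * (k * k * dot (A z (vsub x y)) (vsub x y)
  + k * dot (vsub x z) (vsub x z) + delta * rho x).
have fC : C11 f (fun x => vscal (/ lam) (grad_x N A k delta x y z)).
  apply: C11_scal; apply: C11_add; last by apply: C11_scal; exact: (fr_C11 fr).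
  apply: C11_add; apply: C11_scal.
    by apply: (C11_quad (C := C)); [lra | exact: (fr_sym fr)].
  by apply: (@C11_quad _ (fun x => x) 1); [lra | exact: sym_op_id].
have [] := sub _ _ _ t x (C1_test (/ lam * l) s (- (/ lam * beta)) fC).
  split=> //; exists 1; split; first lra.
  move=> t' x' Q' _ _; have := hmax t' x' Q'; rewrite /f.
  set qq := dot (A z _) _; set qq' := dot (A z (vsub x y)) _.
  set w := dot _ (vsub x' z); set w' := dot _ (vsub x z) => h.
  apply: (Rmult_le_reg_l _ _ _ l0).
  have e t1 x1 q1 w1 : lam * (u t1 x1 - (/ lam * l * ((t1 - s) * (t1 - s)) + - (/ lam * beta) * t1
     + / lam * (k * k * q1 + k * w1 + delta * rho x1)))
    = lam * u t1 x1 + beta * t1 - delta * rho x1 - l * ((t1 - s) * (t1 - s)) - k * k * q1 - k * w1.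
    by field; lra.
  by rewrite !e.
set E0 := Eop _ _ _ _ _ _ _ _ => hO hB.
have EE : E0 <= 0 -> u t x <= psi t x \/ beta - 2 * l * (t - s)
    + lam * Ham b sigma t x (vscal (/ lam) (grad_x N A k delta x y z)) <= 0.
  rewrite /E0 /Eop; set H := Ham _ _ _ _ _.
  rewrite /Rmin; case: Rle_dec => [_ h|_ h]; last by left; lra.
  right; have := Rmult_le_compat_l _ _ _ (Rlt_le _ _ l0) h.
  have -> : lam * (- (2 * (/ lam * l) * (t - s) + - (/ lam * beta)) + H)
    = beta - 2 * l * (t - s) + lam * H by field; lra.
  lra.
case: (clos_interior_or_bdry Qtx.2) => [Ox|bx]; first by apply: EE; apply: hO.
apply: EE; have := hB bx; rewrite dotZl => hmin.
have := Rmult_lt_0_compat _ _ il (hbd bx); move: hmin.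
by rewrite {1}/Rmin; case: Rle_dec; lra.
Qed.

(** A nonnegative minimum gives both inequalities at once when [s < T]; at [s = T] the definition
    yields only the one with [psi]. *)
Lemma super_at_max d m T (O : vec d -> Prop) gamma rho N A C c b
  (sigma : R -> vec d -> mat d m) psi v delta k l t s x y z :
  oblique_frame O gamma rho N A C c -> visc_super T O gamma b sigma psi v ->
  clos O z -> inQ T O s y ->
  (forall s' y', inQ T O s' y' ->
    v s y + delta * rho y + l * ((s - t) * (s - t)) + k * k * dot (A z (vsub y x)) (vsub y x)
    <= v s' y' + delta * rho y' + l * ((s' - t) * (s' - t))
      + k * k * dot (A z (vsub y' x)) (vsub y' x)) ->
  (bdry O y -> dot (grad_y N A k delta x y z) (gamma y) < 0) ->
  psi s y <= v s y /\
  (s < T -> 0 <= - (2 * l * (t - s)) + Ham b sigma s y (grad_y N A k delta x y z)).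
Proof.
move=> fr sup cz Qsy hmin hbd; have C1 := fr_C fr.
pose f y := - (k * k) * dot (A z (vsub y x)) (vsub y x) + - delta * rho y.
have fC : C11 f (fun y => grad_y N A k delta x y z).
  apply: C11_add; last by apply: C11_scal; exact: (fr_C11 fr).
  by apply: C11_scal; apply: (C11_quad (C := C)); [lra | exact: (fr_sym fr)].
have [] := sup _ _ _ s y (C1_test (- l) t 0 fC).
  split=> //; exists 1; split; first lra.
  by move=> s' y' Q' _ _; have := hmin s' y' Q'; rewrite /f; lra.
set E0 := Eop _ _ _ _ _ _ _ _ => h1 [h2 [h3 h4]].
have EE : E0 >= 0 -> psi s y <= v s y /\
  (s < T -> 0 <= - (2 * l * (t - s)) + Ham b sigma s y (grad_y N A k delta x y z)).
  rewrite /E0 /Eop; cbv beta; set H := Ham _ _ _ _ _; set e1 := (e1 in Rmin e1 _); set e2 := v s y - psi s y.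
  have m1 := Rmin_l e1 e2; have m2 := Rmin_r e1 e2 => h.
  have p1 : 0 <= e1 by lra.
  have p2 : 0 <= e2 by lra.
  by split=> [|_]; [rewrite /e2 in p2; lra | rewrite /e1 in p1; lra].
have [sT|sT] : s < T \/ s = T by have := Qsy.1; lra.
  apply: EE; case: (clos_interior_or_bdry Qsy.2) => [Oy|byy]; first exact: h1.
  have := h3 sT byy; have := hbd byy.
  by rewrite {1}/Rmax; case: Rle_dec; lra.
split; last lra.
case: (clos_interior_or_bdry Qsy.2) => [Oy|byy]; first by have := h2 sT Oy; lra.
have := h4 sT byy; have := hbd byy.
by rewrite {1}/Rmax; case: Rle_dec; lra.
Qed.


(** * Maxima of the doubled functional: existence, penalty bounds, clustering *)

Definition penalty (d : nat) (A : vec d -> vec d -> vec d) (k l t s : R) (x y z : vec d) : R :=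
  l * ((t - s) * (t - s)) + k * k * dot (A z (vsub x y)) (vsub x y)
    + k * dot (vsub x z) (vsub x z).

(* The [z] variable freezes the metric [A z] while keeping the test functions
   smooth in [x] and [y]; the weight [k] on [|x - z|^2] keeps [z] close to [x]. *)
Definition doubled (d : nat) (rho : vec d -> R) (A : vec d -> vec d -> vec d)
  (u v : R -> vec d -> R) (lam beta delta k l t s : R) (x y z : vec d) : R :=
  lam * u t x - v s y + beta * t - delta * rho x - delta * rho y - penalty A k l t s x y z.

Definition max_doubled (d : nat) (T : R) (O : vec d -> Prop) (rho : vec d -> R)
  (A : vec d -> vec d -> vec d) (u v : R -> vec d -> R) (lam beta delta k l t s : R)
  (x y z : vec d) : Prop :=
  inQ T O t x /\ inQ T O s y /\ clos O z /\
  forall t' s' x' y' z', inQ T O t' x' -> inQ T O s' y' -> clos O z' ->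
    doubled rho A u v lam beta delta k l t' s' x' y' z'
      <= doubled rho A u v lam beta delta k l t s x y z.

Lemma penalty_diag d (A : vec d -> vec d -> vec d) k l t x : penalty A k l t t x x x = 0.
Proof. by rewrite /penalty !dot_vsub_diag; ring. Qed.

Lemma usc_comp X Y (K : X -> Prop) (K' : Y -> Prop) D D' (F : X -> R) (pr : Y -> X) h :
  usc_at K D F (pr h) -> (forall y, K' y -> K (pr y)) ->
  (forall y, D (pr y) (pr h) <= D' y h) -> usc_at K' D' (fun y => F (pr y)) h.
Proof.
move=> uF sub le e e0; have [w [w0 hw]] := uF e e0; exists w; split=> // y Ky Dy.
by apply: hw; [exact: sub | have := le y; lra].
Qed.

Lemma sqr_diff_le a b w M : 0 <= a <= M -> 0 <= b <= M -> Rabs (a - b) <= w ->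
  a * a - b * b <= 2 * M * w.
Proof.
move=> ha hb h; have h1 := Rle_abs (a - b); have h2 := Rabs_pos (a - b).
have -> : a * a - b * b = (a - b) * (a + b) by ring.
apply: Rle_trans (_ : w * (a + b) <= _); first by apply: Rmult_le_compat_r; lra.
by have : w * (a + b) <= w * (2 * M) by [apply: Rmult_le_compat_l; lra]; lra.
Qed.

Lemma penalty_lip d T (O : vec d -> Prop) gamma rho N A C c k l W t s x y z t' s' x' y' z' :
  oblique_frame O gamma rho N A C c -> 0 <= k -> 0 <= l ->
  inQ T O t x -> inQ T O s y -> clos O z -> inQ T O t' x' -> inQ T O s' y' -> clos O z' ->
  Rabs (t' - t) <= W -> vdist x' x <= W -> Rabs (s' - s) <= W -> vdist y' y <= W ->
  vdist z' z <= W ->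
  penalty A k l t s x y z - penalty A k l t' s' x' y' z'
    <= (l * (4 * T) + k * k * (C * C * C + 4 * (C * C)) + k * (4 * C)) * W.
Proof.
move=> fr k0 l0 [ht cx] [hs cy] cz [ht' cx'] [hs' cy'] cz' w1 w2 w3 w4 w5.
have C1 := fr_C fr; have kk : 0 <= k * k by nra.
have CC : 0 <= C * C by nra.
have CCC : 0 <= C * C * C by nra.
have h1 : (t - s) * (t - s) - (t' - s') * (t' - s') <= 4 * T * W.
  have e a : a * a = Rabs a * Rabs a by rewrite -/(Rsqr a) Rsqr_abs.
  rewrite (e (t - s)) (e (t' - s')).
  have : Rabs (t - s) * Rabs (t - s) - Rabs (t' - s') * Rabs (t' - s') <= 2 * T * (2 * W).
    apply: sqr_diff_le.
    - by split; [exact: Rabs_pos | apply: Rabs_le; lra].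
    - by split; [exact: Rabs_pos | apply: Rabs_le; lra].
    apply: Rle_trans (Rabs_triang_inv2 _ _) _.
    have -> : t - s - (t' - s') = (s' - s) + - (t' - t) by ring.
    have := Rabs_triang (s' - s) (- (t' - t)); rewrite Rabs_Ropp; lra.
  lra.
have h2 : dot (A z (vsub x y)) (vsub x y) - dot (A z' (vsub x' y')) (vsub x' y')
    <= (C * C * C + 4 * (C * C)) * W.
  have := frame_quad_lip fr cx cy cz cx' cy' cz'.
  rewrite (vdistC z) (vdistC x) (vdistC y).
  have : C * C * C * vdist z' z <= C * C * C * W by apply: Rmult_le_compat_l.
  have : 2 * (C * C) * (vdist x' x + vdist y' y) <= 2 * (C * C) * (2 * W).
    by apply: Rmult_le_compat_l; lra.
  lra.
have h3 : dot (vsub x z) (vsub x z) - dot (vsub x' z') (vsub x' z') <= 4 * C * W.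
  rewrite -!vdist2.
  have : vdist x z * vdist x z - vdist x' z' * vdist x' z' <= 2 * C * (2 * W).
    apply: sqr_diff_le.
    - by split; [exact: vdist_ge0 | exact: (fr_diam fr)].
    - by split; [exact: vdist_ge0 | exact: (fr_diam fr)].
    have a1 := vdist_tri x' x z; have a2 := vdist_tri z' x' z.
    have b1 := vdist_tri x x' z'; have b2 := vdist_tri z x z'.
    rewrite (vdistC x x') in a1; rewrite (vdistC z z') in b2.
    by apply: Rabs_le; lra.
  lra.
have m1 := Rmult_le_compat_l _ _ _ l0 h1; have m2 := Rmult_le_compat_l _ _ _ kk h2.
have m3 := Rmult_le_compat_l _ _ _ k0 h3; rewrite /penalty; lra.
Qed.

Lemma doubled_max_exists d T (O : vec d -> Prop) gamma rho N A C c u v lam beta delta k l t0 x0 :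
  is_bounded O -> oblique_frame O gamma rho N A C c ->
  usc_on_Q T O u -> lsc_on_Q T O v -> inQ T O t0 x0 ->
  0 < lam -> 0 <= beta -> 0 <= delta -> 0 <= k -> 0 <= l ->
  exists t s x y z, max_doubled T O rho A u v lam beta delta k l t s x y z.
Proof.
move=> bO fr uu lv Q0 l0 b0 d0 k0 ll0; have C1 := fr_C fr.
pose K3 := prod_set (prod_set (Q_set T O) (Q_set T O)) (clos O).
pose D3 := prod_dist (prod_dist (@Q_dist d) (@Q_dist d)) (@vdist d).
have c3 : compact_in K3 D3.
  apply: compact_prod; last exact: compact_clos.
  by apply: compact_prod; apply: compact_Q.
pose F (p : (R * vec d) * (R * vec d) * vec d) :=
  doubled rho A u v lam beta delta k l p.1.1.1 p.1.2.1 p.1.1.2 p.1.2.2 p.2.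
have [] := usc_max (F := F) c3; last first.
- move=> [[[t x] [s y]] z] [[[/= Qt Qs] cz] hmax]; exists t, s, x, y, z.
  split=> //; split=> //; split=> // t' s' x' y' z' Qt' Qs' cz'.
  exact: (hmax (((t', x'), (s', y')), z')).
- by exists (((t0, x0), (t0, x0)), x0); split=> //; case: Q0.
move=> h [[Q1 Q2] cz].
have D30 p q : 0 <= D3 p q.
  by apply: Rle_trans (Rmax_r _ _); exact: vdist_ge0.
have D31 p q : Q_dist p.1.1 q.1.1 <= D3 p q.
  by apply: Rle_trans (Rmax_l _ _); exact: Rmax_l.
have D32 p q : Q_dist p.1.2 q.1.2 <= D3 p q.
  by apply: Rle_trans (Rmax_l _ _); exact: Rmax_r.
have D33 p q : vdist p.2 q.2 <= D3 p q by exact: Rmax_r.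
have u1 : usc_at K3 D3 (fun p => u p.1.1.1 p.1.1.2) h.
  apply: (usc_comp (usc_Q uu Q1 : usc_at _ _ (fun q => u q.1 q.2) ((fun p => p.1.1) h))) => [y [[? _] _]|y] //.
have u2 : usc_at K3 D3 (fun p => - v p.1.2.1 p.1.2.2) h.
  have nv : usc_on_Q T O (fun t x => - v t x).
    move=> t x Qt e e0; have [w [w0 hw]] := lv t x Qt e e0; exists w; split=> // s y Qs h1 h2.
    by have := hw s y Qs h1 h2; lra.
  apply: (usc_comp (usc_Q nv Q2 : usc_at _ _ (fun q => - v q.1 q.2) ((fun p => p.1.2) h))) => [y [[_ ?] _]|y] //.
(* Everything except [lam * u] and [- v] is Lipschitz on the compact product. *)
pose G (p : (R * vec d) * (R * vec d) * vec d) := beta * p.1.1.1 - delta * rho p.1.1.2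
  - delta * rho p.1.2.2 - penalty A k l p.1.1.1 p.1.2.1 p.1.1.2 p.1.2.2 p.2.
have u3 : usc_at K3 D3 G h.
  apply: (usc_lip (C := beta + 2 * delta * C + l * (4 * T) + k * k * (C * C * C + 4 * (C * C)) + k * (4 * C))).
    move=> p [[P1 P2] cz']; set W := D3 p h.
    have W0 : 0 <= W by exact: D30.
    have w1 : Rabs (p.1.1.1 - h.1.1.1) <= W by apply: Rle_trans (D31 p h); exact: Rmax_l.
    have w2 : vdist p.1.1.2 h.1.1.2 <= W by apply: Rle_trans (D31 p h); exact: Rmax_r.
    have w3 : Rabs (p.1.2.1 - h.1.2.1) <= W by apply: Rle_trans (D32 p h); exact: Rmax_l.
    have w4 : vdist p.1.2.2 h.1.2.2 <= W by apply: Rle_trans (D32 p h); exact: Rmax_r.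
    have w5 : vdist p.2 h.2 <= W by exact: D33.
    have r1 := Rle_trans _ _ _ (Rle_abs _) (fr_rho_lip fr Q1.2 P1.2).
    have r2 := Rle_trans _ _ _ (Rle_abs _) (fr_rho_lip fr Q2.2 P2.2).
    have pen := penalty_lip fr k0 ll0 Q1 Q2 cz P1 P2 cz' w1 w2 w3 w4 w5.
    rewrite vdistC in r1; rewrite vdistC in r2.
    have c1 : C * vdist p.1.1.2 h.1.1.2 <= C * W by apply: Rmult_le_compat_l; lra.
    have c2 : C * vdist p.1.2.2 h.1.2.2 <= C * W by apply: Rmult_le_compat_l; lra.
    have n1 := Rmult_le_compat_l _ _ _ d0 (Rle_trans _ _ _ r1 c1).
    have n2 := Rmult_le_compat_l _ _ _ d0 (Rle_trans _ _ _ r2 c2).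
    have n3 := Rmult_le_compat_l _ _ _ b0 (Rle_trans _ _ _ (Rle_abs _) w1).
    rewrite /G; lra.
  by move=> p; exact: D30.
have uF := usc_add (usc_add (usc_scal l0 u1) u2) u3.
move=> e e0; have [w [w0 hw]] := uF e e0; exists w; split=> // p Kp Dp.
by have := hw p Kp Dp; rewrite /G /F /doubled; lra.
Qed.


Lemma penalty_parts d (O : vec d -> Prop) gamma rho N A C c k l t s x y z :
  oblique_frame O gamma rho N A C c -> clos O z -> 0 <= k -> 0 <= l ->
  k * k * (vdist x y * vdist x y) <= C * penalty A k l t s x y z /\
  l * ((t - s) * (t - s)) <= penalty A k l t s x y z /\
  0 <= penalty A k l t s x y z.
Proof.
move=> fr cz k0 l0; have C1 := fr_C fr; have kk : 0 <= k * k by nra.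
have h1 := fr_coer fr (vsub x y) cz; rewrite -vdist2 in h1.
have ts : 0 <= (t - s) * (t - s) by exact: Rle_0_sqr.
have DD : 0 <= vdist x y * vdist x y by exact: Rle_0_sqr.
have AA : 0 <= dot (A z (vsub x y)) (vsub x y) by nra.
have p1 : 0 <= l * ((t - s) * (t - s)) by exact: Rmult_le_pos.
have p2 : 0 <= k * k * dot (A z (vsub x y)) (vsub x y) by exact: Rmult_le_pos.
have p3 : 0 <= k * dot (vsub x z) (vsub x z) by apply: Rmult_le_pos => //; exact: dot_ge0.
rewrite /penalty; split; last by split; lra.
have h2 := Rmult_le_compat_l _ _ _ kk h1.
have : 0 <= C * (l * ((t - s) * (t - s)) + k * dot (vsub x z) (vsub x z)).
  by apply: Rmult_le_pos; lra.
lra.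
Qed.

(** Comparison with the diagonal point [(t, t, x, x, x)], where the penalty vanishes. The bound is
    uniform in [k] and [l], so that both may be chosen in terms of it. *)
Lemma doubled_penalty_bound d T (O : vec d -> Prop) gamma rho N A C c u v lam beta delta Mu Mv :
  oblique_frame O gamma rho N A C c ->
  0 < lam <= 1 -> 0 <= beta -> 0 <= delta ->
  (forall t x, inQ T O t x -> Rabs (u t x) <= Mu) ->
  (forall t x, inQ T O t x -> Rabs (v t x) <= Mv) ->
  exists R0, 0 < R0 /\ forall k l t s x y z,
    max_doubled T O rho A u v lam beta delta k l t s x y z -> penalty A k l t s x y z <= R0.
Proof.
move=> fr [l0 l1] b0 d0 hu hv; have C1 := fr_C fr.
pose M := Rabs Mu + Rabs Mv + beta * Rabs T + 2 * (delta * C).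
have dC : 0 <= delta * C by apply: Rmult_le_pos; lra.
have bT : 0 <= beta * Rabs T by apply: Rmult_le_pos => //; exact: Rabs_pos.
have M0 := Rabs_pos Mu; have M'0 := Rabs_pos Mv.
exists (2 * M + 1); split; first by rewrite /M; lra.
move=> k l t s x y z [Qt [Qs [cz hmax]]].
have := hmax t t x x x Qt Qt Qt.2; rewrite /doubled penalty_diag.
have bd t' x' : inQ T O t' x' -> lam * u t' x' <= Rabs Mu /\ - Rabs Mu <= lam * u t' x' /\
   v t' x' <= Rabs Mv /\ - Rabs Mv <= v t' x' /\
   delta * rho x' <= delta * C /\ - (delta * C) <= delta * rho x'.
  move=> Q'; have := hu t' x' Q'; have := hv t' x' Q'; have := fr_rho fr Q'.2.
  have g1 := Rle_abs Mu; have g2 := Rle_abs Mv.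
  have e1 := Rle_abs (u t' x'); have e2 := Rle_abs (- u t' x').
  have e3 := Rle_abs (v t' x'); have e4 := Rle_abs (- v t' x').
  have e5 := Rle_abs (rho x'); have e6 := Rle_abs (- rho x').
  rewrite !Rabs_Ropp in e2 e4 e6 => f1 f2 f3.
  have q1 : u t' x' <= Rabs Mu by lra.
  have q2 : - Rabs Mu <= u t' x' by lra.
  split; first nra.
  split; first nra.
  split; first lra.
  split; first lra.
  split; first by apply: Rmult_le_compat_l; lra.
  have : delta * - rho x' <= delta * C by apply: Rmult_le_compat_l; lra.
  lra.
have [a1 [a2 [a3 [a4 [a5 a6]]]]] := bd t x Qt.
have [c1 [c2 [c3 [c4 [c5 c6]]]]] := bd s y Qs.
rewrite /M; lra.
Qed.

(** Compactness is applied to [(t, x)] alone, the weights being hidden in the predicate; [(s, y)]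
    follows because the penalty forces it within [tau]. The rate [/ (k * k * k)] beats momenta of
    order [k^2], leaving [1 / k]. *)
Lemma doubled_cluster d m T (O : vec d -> Prop) gamma rho N A C c b (sigma : R -> vec d -> mat d m)
  u v lam beta delta B Mu Mv t0 x0 :
  is_bounded O -> oblique_frame O gamma rho N A C c -> coef_reg T O b sigma B ->
  usc_on_Q T O u -> lsc_on_Q T O v -> inQ T O t0 x0 ->
  0 < lam <= 1 -> 0 <= beta -> 0 <= delta ->
  (forall t x, inQ T O t x -> Rabs (u t x) <= Mu) ->
  (forall t x, inQ T O t x -> Rabs (v t x) <= Mv) ->
  exists th xh, inQ T O th xh /\ forall tau, 0 < tau ->
    exists k l t s x y z, [/\ 1 <= k, 1 <= k * tau & 0 <= l] /\
      max_doubled T O rho A u v lam beta delta k l t s x y z /\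
      [/\ Rabs (t - th) < tau, vdist x xh < tau, Rabs (t - s) <= tau & vdist x y <= tau] /\
      vdist (b t x) (b s x) <= / (k * k * k) /\
      (forall p, vdist (trmul (sigma t x) p) (trmul (sigma s x) p) <= / (k * k * k) * vnorm p).
Proof.
move=> bO fr cr uu lv Q0 hl b0 d0 hu hv; have C1 := fr_C fr.
have [R0 [R00 hR0]] := doubled_penalty_bound fr hl b0 d0 hu hv.
have [] := @compact_Q d T O bO (fun tau p => exists k l s y z, [/\ 1 <= k, 1 <= k * tau & 0 <= l] /\
      max_doubled T O rho A u v lam beta delta k l p.1 s p.2 y z /\
      Rabs (p.1 - s) <= tau /\ vdist p.2 y <= tau /\
      vdist (b p.1 p.2) (b s p.2) <= / (k * k * k) /\
      (forall q, vdist (trmul (sigma p.1 p.2) q) (trmul (sigma s p.2) q) <= / (k * k * k) * vnorm q)).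
- move=> w w' [t x] hw [k [l [s [y [z [[k1 kw l0] [hm [h1 [h2 h3]]]]]]]]].
  exists k, l, s, y, z; split; first by split=> //; nra.
  by split=> //; split; [lra | split=> //; lra].
- move=> tau tau0.
  (* The three terms give [1 <= k], [1 <= k * tau], and [C * R0 <= k * tau^2]; the last forces
     [|x - y| <= tau]. *)
  pose k := 1 + / tau + C * R0 / (tau * tau).
  have it : 0 < / tau by apply: Rinv_0_lt_compat.
  have tt : 0 < tau * tau by nra.
  have CR : 0 < C * R0 by apply: Rmult_lt_0_compat; lra.
  have ctt : 0 < C * R0 / (tau * tau) by apply: Rdiv_lt_0_compat.
  have k1 : 1 <= k by rewrite /k; lra.
  have kt : 1 <= k * tau.
    have -> : k * tau = 1 + (1 + C * R0 / (tau * tau)) * tau by rewrite /k; field; lra.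
    by have : 0 < (1 + C * R0 / (tau * tau)) * tau by [apply: Rmult_lt_0_compat; lra]; lra.
  have ktt : C * R0 <= k * (tau * tau).
    have -> : k * (tau * tau) = C * R0 + (1 + / tau) * (tau * tau) by rewrite /k; field; lra.
    by have : 0 < (1 + / tau) * (tau * tau) by [apply: Rmult_lt_0_compat; lra]; lra.
  have kk : k <= k * k by nra.
  have kkk : 0 < k * k * k by apply: Rmult_lt_0_compat; lra.
  have [w [w0 hw]] := cr_unif cr (Rinv_0_lt_compat _ kkk).
  pose w' := Rmin w tau; have w'0 : 0 < w' by apply: Rmin_glb_lt.
  have w'1 : w' <= w by exact: Rmin_l.
  have w'2 : w' <= tau by exact: Rmin_r.
  have ww : 0 < w' * w' by apply: Rmult_lt_0_compat.
  (* Chosen after [k]: [l (t - s)^2 <= R0 < l w'^2] brings [t - s] below the time modulus at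
     tolerance [/ (k * k * k)]. *)
  pose l := (R0 + 1) / (w' * w').
  have l0 : 0 < l by apply: Rdiv_lt_0_compat; lra.
  have [t [s [x [y [z hm]]]]] := doubled_max_exists bO fr uu lv Q0 hl.1 b0 d0
    (Rle_trans _ _ _ Rle_0_1 k1) (Rlt_le _ _ l0).
  have pen := hR0 _ _ _ _ _ _ _ hm; have [Qt [Qs [cz hmax]]] := hm.
  have [p1 [p2 p3]] := penalty_parts t s x y fr cz (Rle_trans _ _ _ Rle_0_1 k1) (Rlt_le _ _ l0).
  have ts : Rabs (t - s) < w'.
    have e : l * (w' * w') = R0 + 1 by rewrite /l; field; lra.
    have : l * ((t - s) * (t - s)) < l * (w' * w') by lra.
    move/(Rmult_lt_reg_l _ _ _ l0) => sq.
    rewrite -(Rabs_pos_eq w'); last lra.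
    exact: Rsqr_lt_abs_0.
  have xy : vdist x y <= tau.
    have y0 := vdist_ge0 x y.
    have h1 : C * penalty A k l t s x y z <= C * R0 by apply: Rmult_le_compat_l; lra.
    have h2 : k * (vdist x y * vdist x y) <= k * k * (vdist x y * vdist x y).
      by apply: Rmult_le_compat_r => //; nra.
    have : k * (vdist x y * vdist x y) <= k * (tau * tau) by lra.
    move/(Rmult_le_reg_l _ _ _ (Rlt_le_trans _ _ _ Rlt_0_1 k1)) => sq.
    by apply: Rsqr_incr_0 => //; lra.
  have [hb hs] := hw t s x Qt (conj Qs.1 Qt.2) ltac:(lra).
  exists (t, x); split=> //; exists k, l, s, y, z.
  split; first by split=> //; lra.
  have ts' : Rabs (t - s) <= tau by lra.
  by split=> //; split=> //; split.
move=> [th xh] [Qh near_h]; exists th, xh; split=> // tau tau0.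
have [[t x] [Qt [[k [l [s [y [z [h1 [h2 [h3 [h4 [h5 h6]]]]]]]]]] Dp]]] := near_h tau tau0.
have [/= n1 n2] := Q_dist_lt Dp.
exists k, l, t, s, x, y, z; split=> //; split=> //; split=> //.
Qed.


(** * Comparison *)

(** The increment is split at [(s, x)]. In time, [k^-3] times a momentum of order [k^2] is at most
    of order [sg], since [1 <= k * sg]; in space, [|x - y|] times the momentum is of order
    [k^2 |x - y|^2 + delta |x - y|]. *)
Lemma coef_increment d m T (O : vec d -> Prop) b (sigma : R -> vec d -> mat d m) B C k delta sg t s x y q :
  coef_reg T O b sigma B -> inQ T O t x -> inQ T O s y ->
  1 <= C -> 1 <= k -> 1 <= k * sg -> 0 <= delta <= 1 ->
  vdist (b t x) (b s x) <= / (k * k * k) ->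
  (forall p, vdist (trmul (sigma t x) p) (trmul (sigma s x) p) <= / (k * k * k) * vnorm p) ->
  vnorm q <= 2 * (k * k) * C * vdist x y + C * delta ->
  k * k * (vdist x y * vdist x y) <= sg -> vdist x y <= sg -> vdist x y <= C ->
  vdist (b t x) (b s y) * vnorm q <= (3 * (C * C) + 3 * B * C) * sg /\
  vdist (trmul (sigma t x) q) (trmul (sigma s y) q) <= (3 * (C * C) + 3 * B * C) * sg.
Proof.
move=> cr Qt Qs C1 k1 ks [d0 d1] hb hs hq hth hD hDC.
have B0 := cr_B cr; have D0 := vdist_ge0 x y; have q0 := vnorm_ge0 q.
set D := vdist x y in hq hth hD hDC D0.
have kk : 1 <= k * k by nra.
have kkk : 0 < k * k * k by apply: Rmult_lt_0_compat; lra.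
have ik := Rinv_0_lt_compat _ kkk.
have CC : C <= C * C by nra.
have h1 : / (k * k * k) * vnorm q <= 3 * (C * C) * sg.
  apply: (Rmult_le_reg_l _ _ _ kkk).
  rewrite -Rmult_assoc Rinv_r ?Rmult_1_l; last lra.
  have a1 : 2 * (k * k) * C * D <= 2 * (k * k) * C * C.
    by apply: Rmult_le_compat_l => //; apply: Rmult_le_pos; lra.
  have a2 : C * delta <= k * k * (C * C).
    apply: Rle_trans (_ : C * 1 <= _); first by apply: Rmult_le_compat_l; lra.
    have : 1 * (C * C) <= k * k * (C * C) by apply: Rmult_le_compat_r; lra.
    lra.
  apply: Rle_trans (_ : 3 * (k * k * (C * C)) * 1 <= _); first lra.
  have kC : 0 <= 3 * (k * k * (C * C)).
    by have : 0 <= k * k * (C * C) by [apply: Rmult_le_pos; lra]; lra.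
  have := Rmult_le_compat_l _ _ _ kC ks; lra.
have h2 : B * D * vnorm q <= 3 * B * C * sg.
  have a1 := Rmult_le_compat_l _ _ _ D0 hq.
  have a2 : D * (2 * (k * k) * C * D + C * delta) <= 3 * C * sg.
    have b1 : C * (k * k * (D * D)) <= C * sg by apply: Rmult_le_compat_l; lra.
    have b2 : C * D * delta <= C * D * 1.
      by apply: Rmult_le_compat_l => //; apply: Rmult_le_pos; lra.
    have b3 : C * D <= C * sg by apply: Rmult_le_compat_l; lra.
    lra.
  have := Rmult_le_compat_l _ _ _ B0 (Rle_trans _ _ _ a1 a2); lra.
split.
  have := vdist_tri (b s x) (b t x) (b s y).
  have := cr_blip cr Qs.1 Qt.2 Qs.2; rewrite -/D => l1 l2.
  have : vdist (b t x) (b s y) * vnorm q <= (/ (k * k * k) + B * D) * vnorm q.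
    by apply: Rmult_le_compat_r => //; lra.
  lra.
have := vdist_tri (trmul (sigma s x) q) (trmul (sigma t x) q) (trmul (sigma s y) q).
have := @cr_slip _ _ _ _ _ _ _ cr s x y q Qs.1 Qt.2 Qs.2; rewrite -/D.
have := hs q; lra.
Qed.

Lemma comparison d m T (O : vec d -> Prop) gamma rho N A C c b
  (sigma : R -> vec d -> mat d m) psi u v B :
  is_bounded O -> 0 < T ->
  oblique_frame O gamma rho N A C c -> coef_reg T O b sigma B ->
  cont_on_Q T O psi ->
  bounded_on_Q T O u -> usc_on_Q T O u -> visc_sub T O gamma b sigma psi u ->
  bounded_on_Q T O v -> lsc_on_Q T O v -> visc_super T O gamma b sigma psi v ->
  forall t x, inQ T O t x -> u t x <= v t x.
Proof.
move=> bO T0 fr cr cpsi bu uu sub [Mv hv] lv sup t0 x0 Q0.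
have uT := terminal_le bO T0 fr cr cpsi bu uu sub.
have [Mu hu] := bu.
apply: Rnot_lt_le => lt0.
pose eta := u t0 x0 - v t0 x0; have eta0 : 0 < eta by rewrite /eta; lra.
have C1 := fr_C fr; have c0 := fr_c fr; have B0 := cr_B cr.
have Mu0 : 0 <= Mu by apply: Rle_trans (hu _ _ Q0); exact: Rabs_pos.
have CC : C <= C * C by nra.
have BC : 0 <= B * C by apply: Rmult_le_pos; lra.
(* [kap] is [1 - lam]; replacing [u] by [lam * u] costs at most [eta / 8] at each point. *)
pose kap := Rmin (/ 2) (eta / (8 * (Mu + 1))).
have kap0 : 0 < kap by apply: Rmin_glb_lt; [lra | apply: Rdiv_lt_0_compat; lra].
have kap1 : kap <= / 2 by exact: Rmin_l.
have kapM : kap * Mu <= eta / 8.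
  have h : kap <= eta / (8 * (Mu + 1)) by exact: Rmin_r.
  have e : eta / (8 * (Mu + 1)) * (Mu + 1) = eta / 8 by field; lra.
  have : kap * (Mu + 1) <= eta / (8 * (Mu + 1)) * (Mu + 1) by apply: Rmult_le_compat_r; lra.
  lra.
pose lam := 1 - kap; have l0 : 0 < lam < 1 by rewrite /lam; lra.
pose beta := eta / (8 * T).
have beta0 : 0 < beta by apply: Rdiv_lt_0_compat; lra.
have betaT : beta * T = eta / 8 by rewrite /beta; field; lra.
(* With gradient gap [4 * C * delta] and coefficient error [delta], the quantity [B * E + r] of
   [Ham_gap] is [delta * V]. As [delta <= 1], the total loss is at most [delta * Kg]. *)
pose V := 4 * (B * C) + 1.
have VV : 0 <= V * V by exact: Rle_0_sqr.
pose Kg := V * V / (2 * kap) + V.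
have Kg0 : 1 <= Kg.
  have : 0 <= V * V / (2 * kap).
    by apply: Rmult_le_pos => //; apply: Rlt_le; apply: Rinv_0_lt_compat; lra.
  rewrite /Kg /V; lra.
pose delta := Rmin (Rmin 1 (eta / (32 * C))) (beta / (2 * Kg)).
have delta0 : 0 < delta.
  apply: Rmin_glb_lt; last by apply: Rdiv_lt_0_compat; lra.
  by apply: Rmin_glb_lt; [lra | apply: Rdiv_lt_0_compat; lra].
have delta1 : delta <= 1 by apply: Rle_trans (Rmin_l _ _) (Rmin_l _ _).
have deltaC : 4 * (delta * C) <= eta / 8.
  have h : delta <= eta / (32 * C) by apply: Rle_trans (Rmin_l _ _) (Rmin_r _ _).
  have e : eta / (32 * C) * C = eta / 32 by field; lra.
  have : delta * C <= eta / (32 * C) * C by apply: Rmult_le_compat_r; lra.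
  lra.
have deltaK : delta * Kg < beta.
  have h : delta <= beta / (2 * Kg) by exact: Rmin_r.
  have e : beta / (2 * Kg) * Kg = beta / 2 by field; lra.
  have : delta * Kg <= beta / (2 * Kg) * Kg by apply: Rmult_le_compat_r; lra.
  lra.
pose C5 := 3 * (C * C) + 3 * B * C.
have C50 : 3 <= C5 by rewrite /C5; lra.
(* The bound imposed on [theta]: the first entry makes the oblique derivatives strict in
   [penalty_gradients], the second brings the errors of [coef_increment] below [delta]. *)
pose sg := Rmin (delta * c / (12 * (C * C))) (delta / C5).
have dc : 0 < delta * c by exact: Rmult_lt_0_compat.
have sg0 : 0 < sg by apply: Rmin_glb_lt; apply: Rdiv_lt_0_compat; lra.
have sgc : 6 * (C * C) * sg < delta * c.
  have h : sg <= delta * c / (12 * (C * C)) by exact: Rmin_l.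
  have e : C * C * (delta * c / (12 * (C * C))) = delta * c / 12 by field; lra.
  have : C * C * sg <= C * C * (delta * c / (12 * (C * C))) by apply: Rmult_le_compat_l; lra.
  lra.
have sg5 : C5 * sg <= delta.
  have h : sg <= delta / C5 by exact: Rmin_r.
  have e : C5 * (delta / C5) = delta by field; lra.
  by rewrite -e; apply: Rmult_le_compat_l; lra.
have sgd : sg <= delta.
  by have : 1 * sg <= C5 * sg by [apply: Rmult_le_compat_r; lra]; lra.
pose tol := Rmin (eta / 16) (sg / (3 * C)).
have tol0 : 0 < tol by apply: Rmin_glb_lt; [lra | apply: Rdiv_lt_0_compat; lra].
have tol1 : tol <= eta / 16 by exact: Rmin_l.
have tol2 : C * (3 * tol) <= sg.
  have h : tol <= sg / (3 * C) by exact: Rmin_r.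
  have e : 3 * C * (sg / (3 * C)) = sg by field; lra.
  have : 3 * C * tol <= 3 * C * (sg / (3 * C)) by apply: Rmult_le_compat_l; lra.
  lra.
have [th [xh [Qh near_h]]] := doubled_cluster bO fr cr uu lv Q0 (conj l0.1 (Rlt_le _ _ l0.2))
  (Rlt_le _ _ beta0) (Rlt_le _ _ delta0) hu hv.
have [w1 [w10 hw1]] := uu th xh Qh tol tol0.
have [w2 [w20 hw2]] := lv th xh Qh tol tol0.
have [w3 [w30 hw3]] := cpsi th xh Qh tol tol0.
(* If the cluster time lies below [T], so does [s]; hence [s = T] can occur only when [th = T]. *)
have [gT [gT0 hgT]] : exists g, 0 < g /\ (th < T -> 2 * g <= T - th).
  case: (Rlt_dec th T) => h; last by exists 1; split=> //; lra.
  by exists ((T - th) / 2); split; lra.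
pose om := Rmin (Rmin (Rmin w1 (w2 / 2)) (w3 / 2)) (Rmin (Rmin gT sg) (tol / (beta + 3 * C))).
have om0 : 0 < om.
  by do ![apply: Rmin_glb_lt]; try lra; apply: Rdiv_lt_0_compat; lra.
have omw1 : om <= w1 by apply: Rle_trans (Rmin_l _ _) (Rle_trans _ _ _ (Rmin_l _ _) (Rmin_l _ _)).
have omw2 : 2 * om <= w2.
  have : om <= w2 / 2 by apply: Rle_trans (Rmin_l _ _) (Rle_trans _ _ _ (Rmin_l _ _) (Rmin_r _ _)).
  lra.
have omw3 : 2 * om <= w3.
  have : om <= w3 / 2 by apply: Rle_trans (Rmin_l _ _) (Rmin_r _ _).
  lra.
have omg : om <= gT by apply: Rle_trans (Rmin_r _ _) (Rle_trans _ _ _ (Rmin_l _ _) (Rmin_l _ _)).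
have omsg : om <= sg by apply: Rle_trans (Rmin_r _ _) (Rle_trans _ _ _ (Rmin_l _ _) (Rmin_r _ _)).
have omt : (beta + 3 * C) * om <= tol.
  have h : om <= tol / (beta + 3 * C) by apply: Rle_trans (Rmin_r _ _) (Rmin_r _ _).
  have e : (beta + 3 * C) * (tol / (beta + 3 * C)) = tol by field; lra.
  by rewrite -e; apply: Rmult_le_compat_l; lra.
have [k [l [t [s [x [y [z [[k1 kom ll0] [hm [[n1 n2 n3 n4] [hb hs]]]]]]]]]]] := near_h om om0.
have [Qt [Qs [cz hmax]]] := hm.
have m1 : Rabs (s - th) < 2 * om.
  have -> : s - th = (t - th) + - (t - s) by ring.
  by apply: Rle_lt_trans (Rabs_triang _ _) _; rewrite Rabs_Ropp; lra.
have m2 : vdist y xh < 2 * om by have := vdist_tri x y xh; rewrite (vdistC y x); lra.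
have k0 : 0 <= k by lra.
have [pen1 [_ pen0]] := penalty_parts t s x y fr cz k0 ll0.
have nu := hw1 t x Qt ltac:(lra) ltac:(lra).
have nv := hw2 s y Qs ltac:(lra) ltac:(lra).
have npx := Rle_abs (psi t x - psi th xh).
have npx' := hw3 t x Qt ltac:(lra) ltac:(lra).
have npy := Rle_abs (- (psi s y - psi th xh)); rewrite Rabs_Ropp in npy.
have npy' := hw3 s y Qs ltac:(lra) ltac:(lra).
(* The competitor is the diagonal cluster point, so semicontinuity of [u] and [v] there suffices:
   one [tol] for each of them and one for the Lipschitz terms. *)
have pen : penalty A k l t s x y z <= 3 * tol.
  have := hmax th th xh xh xh Qh Qh Qh.2; rewrite /doubled penalty_diag => h.
  have r1 := Rle_trans _ _ _ (Rle_abs _) (fr_rho_lip fr Qh.2 Qt.2); rewrite vdistC in r1.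
  have r2 := Rle_trans _ _ _ (Rle_abs _) (fr_rho_lip fr Qh.2 Qs.2); rewrite vdistC in r2.
  have a1 : lam * (u t x - u th xh) <= lam * tol by apply: Rmult_le_compat_l; lra.
  have a1' : lam * tol <= 1 * tol by apply: Rmult_le_compat_r; lra.
  have a2 : beta * (t - th) <= beta * om.
    by apply: Rmult_le_compat_l; [lra | have := Rle_abs (t - th); lra].
  have a3 : C * vdist x xh <= C * om by apply: Rmult_le_compat_l; lra.
  have a4 : C * vdist y xh <= C * (2 * om) by apply: Rmult_le_compat_l; lra.
  have Com : 0 <= C * om by apply: Rmult_le_pos; lra.
  have a5 : delta * (rho xh - rho x + (rho xh - rho y)) <= delta * (3 * (C * om)).
    by apply: Rmult_le_compat_l; lra.
  have a6 : delta * (3 * (C * om)) <= 1 * (3 * (C * om)) by apply: Rmult_le_compat_r; lra.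
  lra.
have th_sg : k * k * (vdist x y * vdist x y) <= sg.
  apply: Rle_trans pen1 _; apply: Rle_trans tol2; apply: Rmult_le_compat_l; lra.
(* Of the initial gap [eta], two eighths are lost to [kap], one to [beta * T] and one to the four
   [rho] terms. *)
have pos : eta / 2 <= u t x - v s y.
  have := hmax t0 t0 x0 x0 x0 Q0 Q0 Q0.2; rewrite /doubled penalty_diag => h.
  have hu0 := hu _ _ Q0; have hut := hu _ _ Qt.
  have b1 : kap * u t0 x0 <= kap * Mu.
    by apply: Rmult_le_compat_l; [lra | have := Rle_abs (u t0 x0); lra].
  have b2 : kap * - u t x <= kap * Mu.
    apply: Rmult_le_compat_l; first lra.
    by have := Rle_abs (- u t x); rewrite Rabs_Ropp; lra.
  have b3 : beta * (t - t0) <= beta * T.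
    by apply: Rmult_le_compat_l; [lra | have := Qt.1; have := Q0.1; lra].
  have rb x' : clos O x' -> delta * rho x' <= delta * C /\ - (delta * C) <= delta * rho x'.
    move=> cx'; have := fr_rho fr cx'; have := Rle_abs (rho x'); have := Rle_abs (- rho x').
    rewrite Rabs_Ropp => e1 e2 e3.
    have f1 : delta * rho x' <= delta * C by apply: Rmult_le_compat_l; lra.
    have f2 : delta * - rho x' <= delta * C by apply: Rmult_le_compat_l; lra.
    lra.
  have [g1 _] := rb x0 Q0.2; have [_ g2] := rb x Qt.2; have [_ g3] := rb y Qs.2.
  rewrite /lam /eta in h *; rewrite /eta in kapM betaT deltaC; lra.
have hz : k * (vdist x z * vdist x z)
    <= k * k * dot (A x (vsub x y)) (vsub x y) - k * k * dot (A z (vsub x y)) (vsub x y).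
  have := hmax t s x y x Qt Qs Qt.2; rewrite /doubled /penalty dot_vsub_diag vdist2; lra.
have kz := frozen_point_close fr Qt.2 cz k1 hz.
have kz' : k * vdist x z <= C * sg.
  by apply: Rle_trans kz _; apply: Rmult_le_compat_l; lra.
have [gx [gy [gE gq]]] := penalty_gradients (delta := delta) fr Qt.2 Qs.2 cz k1
  (Rlt_le _ _ delta0) kz' th_sg ltac:(lra).
have Sub : u t x <= psi t x \/ beta - 2 * l * (t - s)
    + lam * Ham b sigma t x (vscal (/ lam) (grad_x N A k delta x y z)) <= 0.
  apply: (sub_at_max fr sub l0.1 cz Qt); last by move=> bx; have := gx bx; lra.
  by move=> t' x' Q'; have := hmax t' s x' y z Q' Qs cz; rewrite /doubled /penalty; lra.
have sym_pen a a' : dot (A z (vsub a a')) (vsub a a') = dot (A z (vsub a' a)) (vsub a' a).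
  have [_ [AZ _]] := fr_sym fr cz.
  by rewrite (vsub_opp a' a) AZ dotZl dotZr; ring.
have [v_psi Sup] : psi s y <= v s y /\
    (s < T -> 0 <= - (2 * l * (t - s)) + Ham b sigma s y (grad_y N A k delta x y z)).
  apply: (super_at_max fr sup cz Qs); last by move=> byy; have := gy byy; lra.
  move=> s' y' Q'; have := hmax t s' x y' z Qt Q' cz; rewrite /doubled /penalty.
  rewrite (sym_pen x y') (sym_pen x y); lra.
case: (Rlt_dec s T) => [sT|nsT].
  (* In the obstacle branch, [u t x <= psi t x] and [psi s y <= v s y] bound the gap by [2 * tol],
     which is less than [eta / 2]. *)
  case: Sub => [u_psi|Sub]; first lra.
  have [hbr hsr] := coef_increment cr Qt Qs C1 k1
    (Rle_trans _ _ _ kom (Rmult_le_compat_l _ _ _ k0 omsg)) (conj (Rlt_le _ _ delta0) delta1)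
    hb hs gq th_sg ltac:(lra) (fr_diam fr Qt.2 Qs.2).
  rewrite -/C5 in hbr hsr.
  have gE' : vdist (grad_x N A k delta x y z) (grad_y N A k delta x y z) <= 4 * C * delta.
    apply: Rle_trans gE _.
    by have : 2 * C * sg <= 2 * C * delta by [apply: Rmult_le_compat_l; lra]; lra.
  have := Ham_gap l0 B0 (cr_b cr Qt) (fun p => @cr_s _ _ _ _ _ _ _ cr t x p Qt) (Rle_trans _ _ _ hbr sg5)
    (Rle_trans _ _ _ hsr sg5) gE'.
  have -> : 1 - lam = kap by rewrite /lam; ring.
  have -> : B * (4 * C * delta) + delta = delta * V by rewrite /V; ring.
  have eK : delta * V * (delta * V) / (2 * kap) = delta * (delta * (V * V / (2 * kap))) by field; lra.
  rewrite eK.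
  have W0 : 0 <= V * V / (2 * kap).
    by apply: Rmult_le_pos => //; apply: Rlt_le; apply: Rinv_0_lt_compat; lra.
  have f1 : delta * (V * V / (2 * kap)) <= 1 * (V * V / (2 * kap)) by apply: Rmult_le_compat_r.
  have f2 : delta * (delta * (V * V / (2 * kap))) <= delta * (1 * (V * V / (2 * kap))).
    by apply: Rmult_le_compat_l; lra.
  (* On subtraction the terms [2 * l * (t - s)] cancel, so [beta] would be at most [delta * Kg]. *)
  have := Sup sT; rewrite /Kg in deltaK.
  have f3 : delta * V = 4 * (B * C) * delta + delta by rewrite /V; ring.
  lra.
have eT : th = T.
  apply: NNPP => ne; have thT : th < T by have := Qh.1; lra.
  have := hgT thT; have := Rle_abs (s - th); lra.
(* The terminal bound is used at the cluster point [(T, xh)], since [t] itself may be below [T];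
   semicontinuity of [u] and continuity of [psi] transfer it to [(t, x)] and [(s, y)]. *)
have := uT xh Qh.2; rewrite eT in nu npy npy'; lra.
Qed.

Theorem mainTheorem17
  (d m : nat) (T : R) (O : vec d -> Prop) (n : vec d -> vec d)
  (gamma : vec d -> vec d) (c0 : R)
  (b : R -> vec d -> vec d) (sigma : R -> vec d -> mat d m)
  (psi u v : R -> vec d -> R)
  (HT : 0 < T)
  (HO : W2inf_domain O n)
  (Hgamma_lip : exists L, forall x y, vdist (gamma x) (gamma y) <= L * vdist x y)
  (Hc0 : 0 < c0)
  (Hgamma_n : forall x, bdry O x -> dot (gamma x) (n x) >= c0)
  (Hb_cont : vcont_on_Q T O b)
  (Hsigma_cont : mcont_on_Q T O sigma)
  (Hlip : exists L, forall t x y, 0 <= t <= T -> clos O x -> clos O y ->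
            vdist (b t x) (b t y) <= L * vdist x y /\
            mdist (sigma t x) (sigma t y) <= L * vdist x y)
  (Hpsi : cont_on_Q T O psi)
  (Hu_bd : bounded_on_Q T O u) (Hu_usc : usc_on_Q T O u)
  (Hu_sub : visc_sub T O gamma b sigma psi u)
  (Hv_bd : bounded_on_Q T O v) (Hv_lsc : lsc_on_Q T O v)
  (Hv_super : visc_super T O gamma b sigma psi v) :
  forall t x, 0 <= t <= T -> clos O x -> u t x <= v t x.
Proof.
have [rho [N [A [C [c fr]]]]] := frame_exists HO Hgamma_lip Hc0 Hgamma_n.
have bO := HO.1; have [B cr] := coef_reg_exists bO Hb_cont Hsigma_cont Hlip.
move=> t x ht cx.
exact: (comparison bO HT fr cr Hpsi Hu_bd Hu_usc Hu_sub Hv_bd Hv_lsc Hv_super (conj ht cx)).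
Qed.
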